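(* Let $p$ be an atoral stable polynomial on $\mathbb{D}^2$ with a zero at $\tau\in\mathbb{T}^2$. Then there is a list of integrability indices $\mathfrak{p}_1,\dots,\mathfrak{p}_M,\mathfrak{p}_{M+1}$ of $p^2$ at $\tau$ with $M\le N_\tau(p,\tilde p)$ and $\mathfrak{p}_{M+1}=\infty$ such that if $q\in(p,\tilde p)R_\tau$, then $$\sup_{\mathfrak{p}'>0}\left\{\mathfrak{p}':\partial_{z_1}(q/p)\in L^{\mathfrak{p}'}_\tau(\mathbb{T}^2)\right\}=\mathfrak{p}_j\quad\text{for some } j \text{ with } 1\le j\le M+1.$$
   Context: $\mathbb{D}$ is the open unit disk, $\mathbb{T}$ the unit circle. For $p\in\mathbb{C}[z_1,z_2]$ of bidegree $(n_1,n_2)$, $\tilde p(z)=z_1^{n_1}z_2^{n_2}\overline{p(1/\bar z_1,1/\bar z_2)}$. $p$ is atoral stable on $\mathbb{D}^2$ if it has no zeros in $\mathbb{D}^2$ and no nonconstant factor in common with $\tilde p$. $R_\tau$ is the ring of convergent power series in $z_1,z_2$ centered at $\tau$; $(p,\tilde p)R_\tau$ is the ideal generated by $p,\tilde p$; $N_\tau(p,\tilde p)=\dim_{\mathbb{C}}\left(R_\tau/(p,\tilde p)R_\tau\right)$ is the (finite) intersection multiplicity of $p$ and $\tilde p$ at $\tau$. For $\mathfrak{p}>0$, $L^{\mathfrak{p}}_\tau(\mathbb{T}^2)$ is the set of $f$ such that $f\in L^{\mathfrak{p}}(U_\tau)$ for some open $U_\tau\subseteq\mathbb{T}^2$ with $\tau\in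 U_\tau$. A (possibly infinite) number $\mathfrak{p}>0$ is an integrability index of $P$ at $\tau$ (here $P=p^2$) if there is $Q\in R_\tau$ with $\mathfrak{p}=\sup\{\mathfrak{p}'>0:Q/P\in L^{\mathfrak{p}'}_\tau(\mathbb{T}^2)\}$. *)

(* Defs.v *)
From HB Require Import structures.
From mathcomp Require Import all_boot all_order all_algebra polyXY complex.
From mathcomp Require Import all_classical all_reals all_analysis.
Set Implicit Arguments.
Unset Strict Implicit.
Unset Printing Implicit Defensive.
Import Order.TTheory GRing.Theory Num.Theory.
Import numFieldNormedType.Exports.
Local Open Scope classical_set_scope.
Local Open Scope ring_scope.
Local Open Scope complex_scope.

(* R[i] itself carries no topology in the libraries; the usual one of the
   complex plane is the one found on the numFieldType R[i]^o. *)

Section Polynomials.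
Variable R : realType.
Local Notation C := R[i].
Implicit Types (p : {poly {poly C}}) (z tau : C * C).

(* In {poly {poly C}} the outer indeterminate is z_1 and the inner one z_2, so
   p`_j`_k is the coefficient of z_1^j z_2^k. *)
Definition ev p z : C := p.[z.1%:P].[z.2].

Definition deg1 p : nat := (size p).-1.
Definition deg2 p : nat := (sizeY p).-1.

Definition reflection p : {poly {poly C}} :=
  \poly_(j < (deg1 p).+1) \poly_(k < (deg2 p).+1)
    conjc (p`_(deg1 p - j)`_(deg2 p - k)).

Lemma ev_sum p z m n : (size p <= m)%N -> (sizeY p <= n)%N ->
  ev p z = \sum_(j < m) \sum_(k < n) p`_j`_k * z.1 ^+ j * z.2 ^+ k.
Proof.
move=> pm pn; rewrite /ev (horner_coef_wide _ pm) horner_sum.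
apply: eq_bigr => j _.
rewrite hornerM -polyC_exp hornerC.
rewrite (@horner_coef_wide _ n); last exact: leq_trans (max_size_coefXY _ _) pn.
by rewrite mulr_suml; apply: eq_bigr => k _; rewrite mulrAC.
Qed.

Lemma ev_reflection p z : z.1 != 0 -> z.2 != 0 ->
  ev (reflection p) z =
  z.1 ^+ deg1 p * z.2 ^+ deg2 p * conjc (ev p ((conjc z.1)^-1, (conjc z.2)^-1)).
Proof.
move=> z1 z2.
rewrite (@ev_sum _ z (deg1 p).+1 (deg2 p).+1); first last.
- rewrite /sizeY; apply/bigmax_leqP => j _.
  rewrite coef_poly; case: ifP => _; first exact: size_poly.
  by rewrite size_poly0.
- exact: size_poly.
rewrite (@ev_sum p _ (deg1 p).+1 (deg2 p).+1) ?leqSpred //.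
rewrite rmorph_sum mulr_sumr (reindex_inj rev_ord_inj) /=.
apply: eq_bigr => j _.
rewrite rmorph_sum mulr_sumr (reindex_inj rev_ord_inj) /=.
apply: eq_bigr => k _.
have jn : (j <= deg1 p)%N by rewrite -ltnS ltn_ord.
have kn : (k <= deg2 p)%N by rewrite -ltnS ltn_ord.
rewrite !subSS coef_poly ltnS leq_subr coef_poly ltnS leq_subr !subKn //.
rewrite !rmorphM !rmorphXn !fmorphV /=.
have conjK (x : C) : conjc (conjc x) = x by case: x => u v /=; rewrite opprK.
rewrite !conjK !exprVn.
have expfB_ (x : C) m n : x != 0 -> (m <= n)%N ->
    x ^+ (n - m) = x ^+ n * (x ^+ m)^-1.
  by move=> x0 mn; rewrite expfB_cond ?(negPf x0).
have mulACAC (c A a B b : C) : c * (A * a) * (B * b) = A * B * (c * a * b).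
  by rewrite -!mulrA [LHS]mulrCA [a * (B * b)]mulrCA [c * (B * _)]mulrCA.
by rewrite !expfB_ // mulACAC.
Qed.

Definition atoral_stable p : Prop :=
  (forall z, `|z.1| < 1 -> `|z.2| < 1 -> ev p z != 0) /\
  (forall d a b : {poly {poly C}}, p = d * a -> reflection p = d * b ->
     exists c : C, d = c%:P%:P).

End Polynomials.

Section LocalRing.
Variable R : realType.
Local Notation C := R[i].
Implicit Types (p : {poly {poly C}}) (z tau : C * C).

(* The germ sum_(j, k) a j k (z_1 - tau_1)^j (z_2 - tau_2)^k is represented by
   its coefficients a; R_tau is the set of the convergent ones. *)
Definition dseries := nat -> nat -> C.
Implicit Types a b f : dseries.

Definition convergent a : Prop :=
  exists2 r : R, 0 < r &
    exists M : R, forall n : nat,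
      \sum_(j < n) \sum_(k < n) ComplexField.Normc.normc (a j k) * r ^+ (j + k)
        <= M.

Definition ds_mul a b : dseries := fun j k =>
  \sum_(j' < j.+1) \sum_(k' < k.+1) a j' k' * b (j - j')%N (k - k')%N.

(* Meaningful for a convergent and z close to tau. *)
Definition ds_eval tau a z : C :=
  lim ((fun n : nat => (\sum_(j < n) \sum_(k < n)
          a j k * (z.1 - tau.1) ^+ j * (z.2 - tau.2) ^+ k) : C^o) @ \oo).

Definition translate tau p : {poly {poly C}} :=
  (map_poly (comp_poly ('X + tau.2%:P)) p) \Po ('X + tau.1%:P%:P).

Lemma ev_translate tau p w :
  ev (translate tau p) w = ev p (tau.1 + w.1, tau.2 + w.2).
Proof.
rewrite /ev /translate horner_comp !hornerE /= -polyCD.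
have -> : (w.1 + tau.1)%:P = ((tau.1 + w.1)%:P \Po ('X + tau.2%:P)).
  by rewrite comp_polyC addrC.
by rewrite horner_map /= horner_comp !hornerE [w.2 + _]addrC.
Qed.

Definition taylor tau p : dseries := fun j k => (translate tau p)`_j`_k.

Definition in_ideal tau p1 p2 f : Prop :=
  exists u v : dseries, [/\ convergent u, convergent v &
    forall j k, f j k = ds_mul u (taylor tau p1) j k
                        + ds_mul v (taylor tau p2) j k].

(* e induces a basis of R_tau / (p1, p2) R_tau *)
Definition quotient_basis tau p1 p2 N (e : 'I_N -> dseries) : Prop :=
  (forall i, convergent (e i)) /\
  (forall f, convergent f -> exists! c : {ffun 'I_N -> C},
     in_ideal tau p1 p2 (fun j k => f j k - \sum_(i < N) c i * e i j k)).

(* The dimension of R_tau / (p1, p2) R_tau, with value 0 if it is infinite. *)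
Definition intersection_multiplicity tau p1 p2 : nat :=
  xget 0%N [set N | exists e : 'I_N -> dseries, quotient_basis tau p1 p2 e].

End LocalRing.

Section Integrability.
Variable R : realType.
Local Notation C := R[i].
Local Notation mu := (@lebesgue_measure R).
Implicit Types (p P : {poly {poly C}}) (z tau : C * C) (f : C * C -> C).

Definition torus_pt (t : measurableTypeR R * measurableTypeR R) : C * C :=
  (cos t.1 +i* sin t.1, cos t.2 +i* sin t.2).

Definition torus_angles (V : set (C^o * C^o)) :
    set (measurableTypeR R * measurableTypeR R) :=
  (`]- pi, pi] `*` `]- pi, pi]) `&` torus_pt @^-1` V.

(* The open subsets of the torus are the traces on it of the open subsets V
   of C^2. *)
Definition Lp_loc (s : R) tau f : Prop :=
  exists V : set (C^o * C^o), [/\ open V, V tau,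
    measurable_fun (torus_angles V) (fun t => complex.Re (f (torus_pt t))),
    measurable_fun (torus_angles V) (fun t => complex.Im (f (torus_pt t))) &
    (\int[mu \x mu]_(t in torus_angles V)
       (ComplexField.Normc.normc (f (torus_pt t)) `^ s)%:E < +oo)%E].

Definition integrability_sup tau f : \bar R :=
  ereal_sup [set s%:E | s in [set s : R | 0 < s /\ Lp_loc s tau f]].

Definition germ_quotient tau (q : dseries R) P z : C := ds_eval tau q z / ev P z.

Definition integrability_index tau P (x : \bar R) : Prop :=
  (0 < x)%E /\
  exists2 Q : dseries R, convergent Q &
    x = integrability_sup tau (germ_quotient tau Q P).

Definition dz1 f z : C := (fun w => f (w, z.2) : C^o)^`()%classic z.1.

End Integrability.

(* Main.v *)
(* On the torus |p~| = |p|, so p~/p is unimodular.  For q = u p + v p~ one has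
     d/dz_1 (q/p) = u' + v' p~/p + v W/p^2,   W = p~' p - p~ p',
   and the first two terms are bounded near tau, so that d/dz_1 (q/p) and
   v W/p^2 have the same local integrability.  If v itself lies in the ideal (p, p~), then
   v W/p^2 is bounded.  Hence chi(v) := sup {s : v W/p^2 in L^s} depends only on
   the class of v in the quotient R_tau/(p, p~); since chi(v + w) is at least
   min (chi v) (chi w), vectors with distinct finite values of chi are linearly
   independent, and chi takes at most N_tau(p, p~) finite values on it.
   Every value is positive because a small negative power of |p| is integrable:
   factoring p in one variable bounds the measure of {|p| < c eta^D} by K eta.
   The quotient is finite-dimensional because (p, p~) contains a nonzero
   polynomial in each of the two variables alone (resultants and Gauss's lemma),
   that is, a unit times a power of z_i - tau_i. *)
Require Import Defs.
From mathcomp Require Import all_boot all_order all_algebra polyXY complex.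
From mathcomp Require Import all_classical all_reals all_analysis measurable_realfun.
From mathcomp Require Import ring lra zify.
Set Implicit Arguments.
Unset Strict Implicit.
Unset Printing Implicit Defensive.
Import Order.TTheory GRing.Theory Num.Theory.
Import numFieldNormedType.Exports.
Local Open Scope classical_set_scope.
Local Open Scope ring_scope.
Local Open Scope complex_scope.

(** * Complex numbers and double series *)

(** Two obstacles shape the statements. The quotient rule holds only where [p] does not vanish, and
    the values taken at a zero of [p] are conventional. On the torus a zero of [p] is also a zero of
    p~, and common zeros are isolated, so [tau] is the only bad point nearby. Identities are
    therefore claimed for [z <> tau], and [Lp_loc] is shown not to see the value at [tau]. Moreover
    [Lp_loc] asks for measurability, so every comparison of sizes comes with a measurability
    argument, which rests on polynomials in [torus_pt] and their pointwise limits.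

    The index chi(v) belongs to the germ [v W] over [p ^+ 2], so it is an integrability index of
    [p ^+ 2] as soon as it is positive. Positivity has content: the supremum runs over positive
    exponents, and an empty set of them would give [-oo]. The exponents in question may be below 1,
    where L^s has no norm, so sums are estimated by [|a + b| <= 2 max(|a|, |b|)]. *)

Section ComplexNorm.
Variable R : realType.
Local Notation C := R[i].
Local Notation nc := (@ComplexField.Normc.normc R).
Implicit Types (x y z : C).

Lemma normC_nc z : `|z| = (nc z)%:C.
Proof. by []. Qed.

Lemma nc_ge0 z : 0 <= nc z.
Proof. by case: z => a b; exact: sqrtr_ge0. Qed.

Lemma ncD x y : nc (x + y) <= nc x + nc y.
Proof. by rewrite -lecR rmorphD /= -!normC_nc ler_normD. Qed.

Lemma ncN x : nc (- x) = nc x.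
Proof. by apply: (@complexI R); rewrite -!normC_nc normrN. Qed.

Lemma ncB x y : nc (x - y) = nc (y - x).
Proof. by rewrite -opprB ncN. Qed.

Lemma ler_nc_dist x y : `|nc x - nc y| <= nc (x - y).
Proof.
have hB a b : nc a - nc b <= nc (a - b).
  by rewrite lerBlDr (le_trans _ (ncD _ _)) // subrK.
by rewrite ler_norml lerNl opprB hB ncB hB.
Qed.

Lemma ncM x y : nc (x * y) = nc x * nc y.
Proof. exact: ComplexField.Normc.normcM. Qed.

Lemma ncV x : nc x^-1 = (nc x)^-1.
Proof. exact: ComplexField.Normc.normcV. Qed.

Lemma nc0 : nc 0 = 0.
Proof. exact: ComplexField.Normc.normc0. Qed.

Lemma nc1 : nc 1 = 1.
Proof. exact: ComplexField.Normc.normc1. Qed.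

Lemma ncX x n : nc (x ^+ n) = nc x ^+ n.
Proof. by elim: n => [|n IH]; rewrite ?nc1 // !exprS ncM IH. Qed.

Lemma nc_eq0 x : (nc x == 0) = (x == 0).
Proof.
by apply/eqP/eqP => [/ComplexField.Normc.eq0_normc //|->]; rewrite nc0.
Qed.

Lemma nc_gt0 x : (0 < nc x) = (x != 0).
Proof. by rewrite lt0r nc_ge0 nc_eq0 andbT. Qed.

Lemma ncMn x n : nc (x *+ n) = nc x *+ n.
Proof. by apply: (@complexI R); rewrite rmorphMn /= -!normC_nc normrMn. Qed.

Lemma nc_nat n : nc n%:R = n%:R.
Proof. by rewrite ncMn nc1. Qed.

Lemma nc_conj x : nc (conjc x) = nc x.
Proof. by case: x => a b /=; rewrite sqrrN. Qed.

Lemma nc_sum (I : Type) (r : seq I) (P : pred I) (F : I -> C) :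
  nc (\sum_(i <- r | P i) F i) <= \sum_(i <- r | P i) nc (F i).
Proof.
elim/big_ind2: _ => [|a b c d ab cd|//]; first by rewrite nc0.
exact: le_trans (ncD _ _) (lerD ab cd).
Qed.

Lemma ler_Re_nc x : `|complex.Re x| <= nc x.
Proof. by rewrite -lecR; exact: normc_ge_Re. Qed.

Lemma ler_Im_nc x : `|complex.Im x| <= nc x.
Proof.
case: x => a b /=.
by rewrite -sqrtr_sqr ler_sqrt ?addr_ge0 ?sqr_ge0 // lerDr sqr_ge0.
Qed.

Lemma ler_nc_ReIm x : nc x <= `|complex.Re x| + `|complex.Im x|.
Proof.
case: x => a b /=; rewrite -[leRHS]ger0_norm ?addr_ge0 // -sqrtr_sqr.
rewrite ler_sqrt ?sqr_ge0 // sqrrD !real_normK ?num_real //.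
by rewrite lerD2r lerDl mulrn_wge0 // mulr_ge0.
Qed.

Lemma ReM x y : complex.Re (x * y) =
  complex.Re x * complex.Re y - complex.Im x * complex.Im y.
Proof. by case: x => a b; case: y. Qed.

Lemma ImM x y : complex.Im (x * y) =
  complex.Re x * complex.Im y + complex.Im x * complex.Re y.
Proof. by case: x => a b; case: y. Qed.

Lemma ReD x y : complex.Re (x + y) = complex.Re x + complex.Re y.
Proof. by case: x => a b; case: y. Qed.

Lemma ImD x y : complex.Im (x + y) = complex.Im x + complex.Im y.
Proof. by case: x => a b; case: y. Qed.

Lemma ReN x : complex.Re (- x) = - complex.Re x.
Proof. by case: x => a b. Qed.

Lemma ImN x : complex.Im (- x) = - complex.Im x.
Proof. by case: x => a b. Qed.

Lemma nc_def x : nc x = Num.sqrt (complex.Re x ^+ 2 + complex.Im x ^+ 2).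
Proof. by case: x. Qed.

Section Limits.
Variables (T : Type) (F : set_system T).
Context {FF : Filter F}.
Implicit Types (u v : T -> C).

(** A positive element of [C] is real, so the radii of the balls of [C^o] are exactly the positive
    reals [e]. *)
Lemma cvgC_ncP u (l : C) : ((u : T -> C^o) @ F --> (l : C^o)) <->
  forall e : R, 0 < e -> \forall t \near F, nc (l - u t) < e.
Proof.
split=> [/cvgrPdist_lt h e e0|h].
  have := h e%:C; rewrite ltcR => /(_ e0).
  by apply: filterS => t; rewrite normC_nc ltcR.
apply/cvgrPdist_lt => -[a b]; rewrite ltcE /= => /andP[/eqP -> a0].
by apply: filterS (h _ a0) => t; rewrite normC_nc ltcR.
Qed.

Lemma cvgC_ReIm u (l : C) : ((u : T -> C^o) @ F --> (l : C^o)) <->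
  ((fun t => complex.Re (u t)) @ F --> complex.Re l /\
   (fun t => complex.Im (u t)) @ F --> complex.Im l).
Proof.
split=> [/cvgC_ncP h|[/cvgrPdist_lt hr /cvgrPdist_lt hi]].
  by split; apply/cvgrPdist_lt => e e0; apply: filterS (h _ e0) => t;
    apply: le_lt_trans; rewrite /= -?ReN -?ImN -?ReD -?ImD
      ?ler_Re_nc ?ler_Im_nc.
apply/cvgC_ncP => e e0.
have e20 : 0 < e / 2 by rewrite divr_gt0.
apply: filterS2 (hr _ e20) (hi _ e20) => t /= h1 h2.
apply: le_lt_trans (ler_nc_ReIm _) _.
by rewrite ReD ImD ReN ImN [ltRHS]splitr ltrD.
Qed.

End Limits.

Lemma cvgCD (u v : nat -> C) (l m : C) :
  (u : nat -> C^o) @ \oo --> (l : C^o) -> (v : nat -> C^o) @ \oo --> (m : C^o) ->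
  (fun n => u n + v n : C^o) @ \oo --> (l + m : C^o).
Proof. by move=> ul vm; exact: (@cvgD C C^o _ _ _ _ _ _ _ ul vm). Qed.

Lemma cvgCB (u v : nat -> C) (l m : C) :
  (u : nat -> C^o) @ \oo --> (l : C^o) -> (v : nat -> C^o) @ \oo --> (m : C^o) ->
  (fun n => u n - v n : C^o) @ \oo --> (l - m : C^o).
Proof. by move=> ul vm; exact: (@cvgB C C^o _ _ _ _ _ _ _ ul vm). Qed.

Lemma cvgCM (u v : nat -> C) (l m : C) :
  (u : nat -> C^o) @ \oo --> (l : C^o) -> (v : nat -> C^o) @ \oo --> (m : C^o) ->
  (fun n => u n * v n : C^o) @ \oo --> (l * m : C^o).
Proof. by move=> ul vm; exact: (@cvgM C _ _ _ _ _ _ _ ul vm). Qed.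

Lemma cvgCMl (c : C) (u : nat -> C) (l : C) :
  (u : nat -> C^o) @ \oo --> (l : C^o) ->
  (fun n => c * u n : C^o) @ \oo --> (c * l : C^o).
Proof. by move=> ul; apply: cvgCM ul; exact: (@cvg_cst C^o). Qed.

Lemma nc_cvg (u : nat -> C) (l : C) :
  (u : nat -> C^o) @ \oo --> (l : C^o) -> (fun n => nc (u n)) @ \oo --> nc l.
Proof.
move/cvgC_ncP => h; apply/cvgrPdist_lt => e e0; apply: filterS (h _ e0) => n.
exact/le_lt_trans/ler_nc_dist.
Qed.

End ComplexNorm.

(** * Square partial sums and Cauchy products of double series *)

Section SquareSums.

(** Stated over any [nmodType] so that it serves both complex terms and their real majorants. *)
Definition dsum (V : nmodType) (F : nat -> nat -> V) (n : nat) : V :=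
  \sum_(j < n) \sum_(k < n) F j k.

(** Both sums get the same index range, so that partial sums of different sizes can be compared term
    by term. *)
Lemma dsum_widen (V : nmodType) (F : nat -> nat -> V) m n : (n <= m)%N ->
  dsum F n =
  dsum (fun j k => if (j < n)%N && (k < n)%N then F j k else 0) m.
Proof.
move=> nm; rewrite /dsum.
rewrite (big_ord_widen m (fun j => \sum_(k < n) F j k) nm) big_mkcond.
apply: eq_bigr => j _; case: ifP => jn /=; last by rewrite big1.
by rewrite (big_ord_widen m _ nm) big_mkcond.
Qed.

Lemma eq_dsum (V : nmodType) (F G : nat -> nat -> V) n :
  (forall j k, F j k = G j k) -> dsum F n = dsum G n.
Proof. by move=> FG; apply: eq_bigr => j _; apply: eq_bigr => k _. Qed.

Lemma dsumD (V : nmodType) (F G : nat -> nat -> V) n :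
  dsum (fun j k => F j k + G j k) n = dsum F n + dsum G n.
Proof.
by rewrite /dsum -big_split; apply: eq_bigr => j _; rewrite -big_split.
Qed.

Lemma dsumN (V : zmodType) (F : nat -> nat -> V) n :
  dsum (fun j k => - F j k) n = - dsum F n.
Proof.
by rewrite /dsum -sumrN; apply: eq_bigr => j _; rewrite -sumrN.
Qed.

Lemma dsumMl (V : pzRingType) c (F : nat -> nat -> V) n :
  dsum (fun j k => c * F j k) n = c * dsum F n.
Proof.
by rewrite /dsum mulr_sumr; apply: eq_bigr => j _; rewrite mulr_sumr.
Qed.

Lemma dsumMr (V : pzRingType) c (F : nat -> nat -> V) n :
  dsum (fun j k => F j k * c) n = dsum F n * c.
Proof.
by rewrite /dsum mulr_suml; apply: eq_bigr => j _; rewrite mulr_suml.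
Qed.

Lemma ler_dsum (V : numDomainType) (F G : nat -> nat -> V) n :
  (forall j k, F j k <= G j k) -> dsum F n <= dsum G n.
Proof. by move=> FG; apply: ler_sum => j _; apply: ler_sum => k _. Qed.

Lemma dsum_ge0 (V : numDomainType) (F : nat -> nat -> V) n :
  (forall j k, 0 <= F j k) -> 0 <= dsum F n.
Proof. by move=> FG; apply: sumr_ge0 => j _; apply: sumr_ge0 => k _. Qed.

Lemma dsum_mono (V : numDomainType) (F : nat -> nat -> V) m n :
  (forall j k, 0 <= F j k) -> (n <= m)%N -> dsum F n <= dsum F m.
Proof.
by move=> F0 nm; rewrite (dsum_widen _ nm); apply: ler_dsum => j k; case: ifP.
Qed.

(** The formula of [ds_mul] over any ring, to be used for the real majorants as well. *)
Definition conv2 (V : pzRingType) (F G : nat -> nat -> V) (j k : nat) : V :=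
  \sum_(j' < j.+1) \sum_(k' < k.+1) F j' k' * G (j - j')%N (k - k')%N.

(* Sum over a triangle: the index (j, i) with i <= j < n is reparametrized as
   (i, l) with i + l < n. *)
Lemma sum_triangle (V : nmodType) (G : nat -> nat -> V) n :
  \sum_(j < n) \sum_(i < j.+1) G i (j - i)%N =
  \sum_(i < n) \sum_(l < n) (if (i + l < n)%N then G i l else 0).
Proof.
elim: n => [|n IH]; first by rewrite !big_ord0.
rewrite big_ord_recr /= IH [RHS]big_ord_recr /=.
have -> : \sum_(i < n) \sum_(l < n.+1) (if (i + l < n.+1)%N then G i l else 0)
  = \sum_(i < n) (\sum_(l < n) (if (i + l < n)%N then G i l else 0)
                  + G i (n - i)%N).
  apply: eq_bigr => i _; rewrite big_ord_recr /=.
  have iln (l : nat) : (i + l < n.+1)%N = (i + l < n)%N || (l == n - i)%N.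
    have := ltn_ord i; lia.
  have [i0|i0] := eqVneq (i : nat) 0%N.
    rewrite i0 add0n ltnSn subn0; congr (_ + _); apply: eq_bigr => l _.
    by rewrite add0n ltn_ord ltnS ltnW.
  have -> : (i + n < n.+1)%N = false by lia.
  have hni : (n - i < n)%N by have := ltn_ord i; lia.
  rewrite addr0 (bigD1 (Ordinal hni)) //= [in RHS](bigD1 (Ordinal hni)) //=.
  have -> : (i + (n - i) < n.+1)%N by have := ltn_ord i; lia.
  have -> : (i + (n - i) < n)%N = false by have := ltn_ord i; lia.
  rewrite add0r addrC; congr (_ + _); apply: eq_bigr => l ln.
  rewrite iln; have -> : ((l : nat) == (n - i)%N) = false.
    by apply/negbTE; apply: contra ln => /eqP ll; apply/eqP/val_inj.
  by rewrite orbF.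
rewrite big_split /= -addrA; congr (_ + _).
rewrite big_ord_recr /=; congr (_ + _).
rewrite big_ord_recl addn0 ltnSn subnn big1 ?addr0 // => l _.
by rewrite /= /bump /= add1n addnS ltnS ltnNge leq_addr.
Qed.

(** [sum_triangle] in each of the two indices: what remains of the full product are the pairs whose
    indices add up to less than [n]. *)
Lemma dsum_conv2 (V : pzRingType) (F G : nat -> nat -> V) n :
  dsum (conv2 F G) n =
  dsum (fun j k => dsum (fun j' k' => if (j + j' < n)%N && (k + k' < n)%N
    then F j k * G j' k' else 0) n) n.
Proof.
rewrite /dsum /conv2.
under eq_bigr => j _ do rewrite exchange_big /=.
transitivity (\sum_(j < n) \sum_(i < j.+1) \sum_(k < n)
   \sum_(l < n) (if (k + l < n)%N then F i k * G (j - i)%N l else 0)).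
  apply: eq_bigr => j _; apply: eq_bigr => i _.
  by rewrite -(sum_triangle (fun k l => F i k * G (j - i)%N l)).
rewrite (sum_triangle (fun i j => \sum_(k < n)
   \sum_(l < n) (if (k + l < n)%N then F i k * G j l else 0))).
apply: eq_bigr => j _; rewrite [RHS]exchange_big /=.
apply: eq_bigr => j' _; case: ifP => jj /=; last first.
  by rewrite big1 // => k _; rewrite big1.
by [].
Qed.

Lemma dsumM (V : pzRingType) (F G : nat -> nat -> V) n :
  dsum F n * dsum G n = dsum (fun j k => dsum (fun j' k' => F j k * G j' k') n) n.
Proof. by rewrite -dsumMr; apply: eq_dsum => j k; rewrite dsumMl. Qed.

Lemma dsum_conv2_le (V : numDomainType) (F G : nat -> nat -> V) n :
  (forall j k, 0 <= F j k) -> (forall j k, 0 <= G j k) ->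
  dsum (conv2 F G) n <= dsum F n * dsum G n.
Proof.
move=> F0 G0; rewrite dsum_conv2 dsumM.
by apply: ler_dsum => j k; apply: ler_dsum => j' k'; case: ifP; rewrite ?mulr_ge0.
Qed.

(* Indices below n/2 add up to indices below n. *)
Lemma dsum_conv2_ge (V : numDomainType) (F G : nat -> nat -> V) n :
  (forall j k, 0 <= F j k) -> (forall j k, 0 <= G j k) ->
  dsum F n./2 * dsum G n./2 <= dsum (conv2 F G) n.
Proof.
move=> F0 G0; rewrite dsum_conv2.
have hn : (n./2 <= n)%N by lia.
rewrite !(dsum_widen _ hn) dsumM.
apply: ler_dsum => j k; apply: ler_dsum => j' k'.
case: ifP => h; last by rewrite mul0r; case: ifP; rewrite ?mulr_ge0.
case: ifP => h'; last by rewrite mulr0; case: ifP; rewrite ?mulr_ge0.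
by have -> : (j + j' < n)%N && (k + k' < n)%N by lia.
Qed.

End SquareSums.

(** * Absolutely convergent double series *)

Section AbsoluteConvergence.
Variable R : realType.
Local Notation C := R[i].
Local Notation nc := (@ComplexField.Normc.normc R).
Implicit Types (F : nat -> nat -> C) (G : nat -> nat -> R).

Lemma nc_dsum F G n : (forall j k, nc (F j k) <= G j k) ->
  nc (dsum F n) <= dsum G n.
Proof.
move=> FG; apply: le_trans (nc_sum _ _ _) _; apply: ler_sum => j _.
by apply: le_trans (nc_sum _ _ _) _; apply: ler_sum => k _.
Qed.

Lemma nc_dsumB F G m n : (forall j k, nc (F j k) <= G j k) -> (n <= m)%N ->
  nc (dsum F m - dsum F n) <= dsum G m - dsum G n.
Proof.
move=> FG nm; rewrite (dsum_widen F nm) (dsum_widen G nm) -!dsumN -!dsumD.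
apply: nc_dsum => j k; case: ifP => _; first by rewrite !subrr nc0.
by rewrite !subr0.
Qed.

Lemma dsum_real_cvg G (M : R) : (forall j k, 0 <= G j k) ->
  (forall n, dsum G n <= M) -> cvgn (dsum G).
Proof.
move=> G0 GM; apply: nondecreasing_is_cvgn.
  by move=> n m nm; exact: dsum_mono.
by exists M => _ [n _ <-].
Qed.

Lemma ge0_of_nc_le F G : (forall j k, nc (F j k) <= G j k) ->
  forall j k, 0 <= G j k.
Proof. by move=> FG j k; apply: le_trans (FG j k); exact: nc_ge0. Qed.

Lemma nc_cvg_le (u : nat -> C) (l : C) (M : R) :
  (u : nat -> C^o) @ \oo --> (l : C^o) ->
  (\forall n \near \oo, nc (u n) <= M) -> nc l <= M.
Proof.
move=> ul uM; have h := nc_cvg ul.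
rewrite -(cvg_lim _ h) //; apply: limr_le => //.
by apply/cvg_ex; exists (nc l).
Qed.

(* [dsum G - u] is nondecreasing and bounded, hence [u] is the difference of two
   convergent sequences. *)
Lemma cauchy_real_cvg (u : nat -> R) G (M : R) : (forall j k, 0 <= G j k) ->
  (forall n, dsum G n <= M) ->
  (forall m n, (n <= m)%N -> `|u m - u n| <= dsum G m - dsum G n) -> cvgn u.
Proof.
move=> G0 GM uG; have cG := dsum_real_cvg G0 GM.
have -> : u = dsum G \- (dsum G \- u).
  by apply/funext => n /=; rewrite opprB addrC subrK.
apply: is_cvgB => //; apply: nondecreasing_is_cvgn.
  move=> n m nm /=; have := le_trans (ler_norm _) (uG _ _ nm); lra.
exists (M + (`|u 0%N| + M)) => _ [n _ <-] /=; apply: lerD => //.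
have := uG _ _ (leq0n n); rewrite distrC => /(le_trans (ler_norm _)).
have := ler_norm (- u 0%N); rewrite normrN; have := GM n.
have := dsum_ge0 0 G0; lra.
Qed.

Lemma dsum_cvg F G (M : R) : (forall j k, nc (F j k) <= G j k) ->
  (forall n, dsum G n <= M) ->
  exists2 l : C, (dsum F : nat -> C^o) @ \oo --> (l : C^o) & nc l <= M.
Proof.
move=> FG GM; have G0 := ge0_of_nc_le FG.
have cr : cvgn (fun n => complex.Re (dsum F n)).
  apply: (cauchy_real_cvg G0 GM) => m n nm; apply: le_trans (nc_dsumB FG nm).
  by rewrite -ReN -ReD ler_Re_nc.
have ci : cvgn (fun n => complex.Im (dsum F n)).
  apply: (cauchy_real_cvg G0 GM) => m n nm; apply: le_trans (nc_dsumB FG nm).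
  by rewrite -ImN -ImD ler_Im_nc.
have cF : (dsum F : nat -> C^o) @ \oo -->
   (Complex (limn (fun n => complex.Re (dsum F n)))
            (limn (fun n => complex.Im (dsum F n))) : C^o).
  by apply/cvgC_ReIm; split.
exists (Complex (limn (fun n => complex.Re (dsum F n)))
                (limn (fun n => complex.Im (dsum F n)))) => //.
apply: (nc_cvg_le cF); near=> n.
exact: le_trans (nc_dsum _ FG) (GM n).
Unshelve. all: by end_near. Qed.

(** The error against the product of the partial sums is at most the error of the majorants. That
    one is squeezed by the product of the majorants' sums and the product of their half-size sums,
    which share a limit. *)
Lemma dsum_conv2_cvg F1 F2 G1 G2 (M1 M2 : R) l1 l2 :
  (forall j k, nc (F1 j k) <= G1 j k) -> (forall j k, nc (F2 j k) <= G2 j k) ->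
  (forall n, dsum G1 n <= M1) -> (forall n, dsum G2 n <= M2) ->
  (dsum F1 : nat -> C^o) @ \oo --> (l1 : C^o) ->
  (dsum F2 : nat -> C^o) @ \oo --> (l2 : C^o) ->
  (dsum (conv2 F1 F2) : nat -> C^o) @ \oo --> (l1 * l2 : C^o).
Proof.
move=> FG1 FG2 GM1 GM2 h1 h2.
have G10 := ge0_of_nc_le FG1; have G20 := ge0_of_nc_le FG2.
have hp : (fun n => dsum F1 n * dsum F2 n : C^o) @ \oo --> (l1 * l2 : C^o).
  exact: cvgCM.
have /cvg_ex[/= L1 L1P] := dsum_real_cvg G10 GM1.
have /cvg_ex[/= L2 L2P] := dsum_real_cvg G20 GM2.
have half : (fun n => n./2) @ \oo --> \oo.
  apply/cvgnyPge => A; exists A.*2 => // n /= An.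
  by rewrite -(doubleK A) half_leq.
pose d n := dsum G1 n * dsum G2 n - dsum G1 n./2 * dsum G2 n./2.
have d0 : d @ \oo --> (0 : R).
  rewrite -(subrr (L1 * L2)); apply: cvgB; first exact: cvgM.
  by apply: cvgM; [exact: (cvg_comp _ _ half L1P)|exact: (cvg_comp _ _ half L2P)].
have key n : nc (dsum F1 n * dsum F2 n - dsum (conv2 F1 F2) n) <= d n.
  rewrite dsumM dsum_conv2 -dsumN -dsumD.
  apply: le_trans (_ : dsum G1 n * dsum G2 n - dsum (conv2 G1 G2) n <= _).
    rewrite dsumM dsum_conv2 -dsumN -dsumD; apply: nc_dsum => j k.
    rewrite -!dsumN -!dsumD; apply: nc_dsum => j' k'.
    case: ifP => _; first by rewrite !subrr nc0.
    by rewrite !subr0 ncM ler_pM ?nc_ge0.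
  by rewrite lerD2l lerN2 dsum_conv2_ge.
have e0 : (fun n => dsum F1 n * dsum F2 n - dsum (conv2 F1 F2) n : C^o) @ \oo
     --> (0 : C^o).
  apply/cvgC_ncP => e e0; move/cvgrPdist_lt: d0 => /(_ _ e0).
  apply: filterS => n; rewrite !sub0r normrN ncN.
  by apply: le_lt_trans; apply: le_trans (key n) (ler_norm _).
rewrite -[l1 * l2]subr0.
have -> : dsum (conv2 F1 F2) = fun n => dsum F1 n * dsum F2 n -
    (dsum F1 n * dsum F2 n - dsum (conv2 F1 F2) n).
  by apply/funext => n; rewrite opprB addrC subrK.
exact: cvgCB hp e0.
Qed.

End AbsoluteConvergence.

(** * Evaluation and differentiation of germs *)

Section ComplexDerivative.
Variable R : realType.
Local Notation C := R[i].
Local Notation nc := (@ComplexField.Normc.normc R).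

Lemma is_derive_quadratic (f : C^o -> C^o) (x d : C) (K rho : R) : 0 < rho ->
  (forall h : C, nc h < rho -> nc (f (h + x) - f x - h * d) <= K * nc h ^+ 2) ->
  is_derive (x : C^o) (1 : C^o) f d.
Proof.
move=> rho0 fK.
(* [K] has no prescribed sign; [1 + |K|] is a positive upper bound of it by which [e] can be
   divided. *)
have K1 : 0 < 1 + `|K| by rewrite ltr_pwDl.
have lim_d : (fun h : C^o => h^-1 *: ((f \o shift (x : C^o)) (h *: (1 : C^o)) - f x))
    @ (0 : C^o)^' --> (d : C^o).
  apply/cvgC_ncP => e e0.
  have m0 : 0 < Num.min rho (e / (1 + `|K|)) by rewrite lt_min rho0 divr_gt0.
  have := @dnbhs0_lt C C^o (Num.min rho (e / (1 + `|K|)))%:C.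
  rewrite ltcR => /(_ m0) nb.
  apply: filterS2 nb (nbhs_dnbhs_neq (0 : C^o)) => h.
  rewrite normC_nc ltcR lt_min => /andP[hr he] h0.
  have -> : (f \o shift (x : C^o)) (h *: (1 : C^o)) = f (h + x).
    by congr f; rewrite /shift /= [h *: 1]mulr1.
  have := fK _ hr.
  have -> : h^-1 *: (f (h + x) - f x) = h^-1 * (f (h + x) - f x) by [].
  have -> : d - h^-1 * (f (h + x) - f x) = - (h^-1 * (f (h + x) - f x - h * d)).
    by rewrite [in RHS]mulrBr mulKf // opprB.
  rewrite ncN ncM ncV => hK.
  have nh0 : 0 < nc h by rewrite nc_gt0.
  rewrite mulrC ltr_pdivrMr //; apply: le_lt_trans hK _.
  rewrite expr2 mulrA ltr_pM2r //.
  apply: le_lt_trans (_ : (1 + `|K|) * nc h < _); last first.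
    by rewrite mulrC -ltr_pdivlMr.
  by rewrite ler_pM2r // (le_trans (ler_norm _)) // lerDr.
apply: DeriveDef; first by apply/cvg_ex; exists d.
exact: cvg_lim lim_d.
Qed.

Lemma is_derive_hornerC (P : {poly C}) (x : C) :
  is_derive (x : C^o) (1 : C^o) (fun w : C^o => P.[w] : C^o) (P^`().[x]).
Proof.
elim/poly_ind: P => [|P c IH].
  have -> : (fun w : C^o => 0.[w] : C^o) = cst 0.
    by apply/funext => w; rewrite horner0.
  by rewrite deriv0 horner0; exact: is_derive_cst.
have -> : (fun w : C^o => (P * 'X + c%:P).[w] : C^o) =
  (fun w : C^o => P.[w] : C^o) * (id : C^o -> C^o) + cst c.
  by apply/funext => w; rewrite !hornerE.
apply: (@is_derive_eq _ _ _ _ _ _ _ _ (is_deriveD (is_deriveM IH (is_derive_id _ _)) (is_derive_cst _ _ _))).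
rewrite derivD derivM derivX derivC !hornerE.
by rewrite [X in X + _]mulr1 addrC; congr (_ + _); exact: mulrC.
Qed.

(** Substituting z_2 first leaves a polynomial in z_1 alone, to which the one-variable derivative
    applies. *)
Lemma ev_horner_map (P : {poly {poly C}}) z :
  ev P z = (map_poly (horner^~ z.2) P).[z.1].
Proof. by rewrite /ev -[in RHS](hornerC z.1 z.2) (horner_map (horner_eval z.2)). Qed.

Lemma is_derive_ev (P : {poly {poly C}}) (x y : C) :
  is_derive (x : C^o) (1 : C^o) (fun w : C^o => ev P (w, y) : C^o)
    (ev P^`() (x, y)).
Proof.
have -> : (fun w : C^o => ev P (w, y) : C^o) =
    (fun w : C^o => (map_poly (horner^~ y) P).[w] : C^o).
  by apply/funext => w; rewrite ev_horner_map.
have := is_derive_hornerC (map_poly (horner_eval y) P) x.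
by rewrite (deriv_map (horner_eval y)) ev_horner_map.
Qed.

End ComplexDerivative.

(** * Evaluation of germs and its compatibility with sums and products *)

Section Evaluation.
Variable R : realType.
Local Notation C := R[i].
Local Notation nc := (@ComplexField.Normc.normc R).
Implicit Types (a b : dseries R) (z tau : C * C) (P : {poly {poly C}}).

Lemma evD P Q z : ev (P + Q) z = ev P z + ev Q z.
Proof. by rewrite /ev !hornerE. Qed.

Lemma evB P Q z : ev (P - Q) z = ev P z - ev Q z.
Proof. by rewrite /ev !hornerE. Qed.

Lemma evM P Q z : ev (P * Q) z = ev P z * ev Q z.
Proof. by rewrite /ev !hornerE. Qed.

Lemma evX P n z : ev (P ^+ n) z = ev P z ^+ n.
Proof. by rewrite /ev !hornerE. Qed.

(** The balls of [C^o * C^o], but with real radii. *)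
Definition box tau (r : R) : set (C^o * C^o) :=
  [set z | nc (z.1 - tau.1) < r /\ nc (z.2 - tau.2) < r].

Lemma ncB_ball (x y : C) (r : R) :
  (nc (y - x) < r) = (`|(x : C^o) - y| < r%:C).
Proof. by rewrite ncB normC_nc ltcR. Qed.

Lemma box_ball tau (r : R) : 0 < r -> box tau r = ball (tau : C^o * C^o) r%:C.
Proof.
move=> r0; apply/seteqP; split => z /=; rewrite /box /ball /= /prod_ball /=.
  by case=> h1 h2; split; rewrite /ball /= -ncB_ball.
by case; rewrite /ball /= -!ncB_ball.
Qed.

Lemma open_box tau r : 0 < r -> open (box tau r).
Proof.
move=> r0; rewrite openE => z [/= h1 h2]; rewrite /interior.
pose d := Num.min (r - nc (z.1 - tau.1)) (r - nc (z.2 - tau.2)).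
have d0 : 0 < d by rewrite lt_min !subr_gt0 h1.
apply/nbhs_ballP; exists d%:C; first by rewrite /= ltcR.
rewrite -box_ball // => w [/=]; rewrite !lt_min !ltrBrDr.
move=> /andP[w1 _] /andP[_ w2]; split => /=.
  by apply: le_lt_trans w1; rewrite (le_trans _ (ncD _ _)) // subrKA.
by apply: le_lt_trans w2; rewrite (le_trans _ (ncD _ _)) // subrKA.
Qed.

Lemma box_center tau r : 0 < r -> box tau r tau.
Proof. by move=> r0; split; rewrite subrr nc0. Qed.

Lemma sub_box tau r s : r <= s -> box tau r `<=` box tau s.
Proof. by move=> rs z [h1 h2]; split; apply: lt_le_trans rs. Qed.

Lemma nbhs_boxP tau (A : set (C^o * C^o)) :
  nbhs (tau : C^o * C^o) A <-> exists2 r : R, 0 < r & box tau r `<=` A.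
Proof.
split=> [/nbhs_ballP[[a b]]|[r r0]].
  rewrite /= ltcE /= => /andP[/eqP -> a0] h; exists a => //.
  by rewrite box_ball.
by rewrite box_ball // => h; apply/nbhs_ballP; exists r%:C; rewrite /= ?ltcR.
Qed.

Definition dterm a (w : C * C) : nat -> nat -> C :=
  fun j k => a j k * w.1 ^+ j * w.2 ^+ k.

Definition abs_bound a (r M : R) :=
  forall n, dsum (fun j k => nc (a j k) * r ^+ (j + k)) n <= M.

Lemma convergentP a :
  convergent a <-> exists2 r : R, 0 < r & exists M, abs_bound a r M.
Proof. by []. Qed.

Lemma abs_bound_le a (r s M : R) : 0 <= s -> s <= r -> abs_bound a r M ->
  abs_bound a s M.
Proof.
move=> s0 sr h n; apply: le_trans (h n); apply: ler_dsum => j k.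
by rewrite ler_wpM2l ?nc_ge0 // lerXn2r // nnegrE (le_trans s0).
Qed.

Lemma nc_dterm a w (r : R) j k : nc w.1 <= r -> nc w.2 <= r ->
  nc (dterm a w j k) <= nc (a j k) * r ^+ (j + k).
Proof.
move=> h1 h2; rewrite !ncM !ncX -mulrA exprD ler_wpM2l ?nc_ge0 //.
by rewrite ler_pM ?exprn_ge0 ?nc_ge0 // lerXn2r ?nnegrE ?nc_ge0 //
   (le_trans _ h1) ?(le_trans _ h2) // nc_ge0.
Qed.

(** On a box with the radius of the bound, the [lim] in [ds_eval] is a true limit and not a default
    value. *)
Lemma ds_eval_cvg a tau (r M : R) z : abs_bound a r M -> box tau r z ->
  (dsum (dterm a (z.1 - tau.1, z.2 - tau.2)) : nat -> C^o) @ \oo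
     --> (ds_eval tau a z : C^o) /\ nc (ds_eval tau a z) <= M.
Proof.
move=> aM [/ltW h1 /ltW h2].
have [l al lM] := dsum_cvg
  (fun j k => @nc_dterm a (z.1 - tau.1, z.2 - tau.2) r j k h1 h2) aM.
by have -> : ds_eval tau a z = l by exact: cvg_lim al.
Qed.

Lemma ds_eval_unique a tau z l :
  (dsum (dterm a (z.1 - tau.1, z.2 - tau.2)) : nat -> C^o) @ \oo --> (l : C^o) ->
  ds_eval tau a z = l.
Proof. by move=> al; exact: cvg_lim al. Qed.

Lemma near_box tau (r : R) : 0 < r -> \forall z \near (tau : C^o * C^o), box tau r z.
Proof. by move=> r0; apply/nbhs_boxP; exists r. Qed.

Lemma ds_eval_near a tau : convergent a -> exists M : R,
  \forall z \near (tau : C^o * C^o),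
  (dsum (dterm a (z.1 - tau.1, z.2 - tau.2)) : nat -> C^o) @ \oo
     --> (ds_eval tau a z : C^o) /\ nc (ds_eval tau a z) <= M.
Proof.
move=> /convergentP[r r0 [M aM]]; exists M; apply: filterS (near_box tau r0) => z.
exact: ds_eval_cvg.
Qed.

Lemma convergent_bound a b : convergent a -> convergent b ->
  exists2 r : R, 0 < r & exists M, abs_bound a r M /\ abs_bound b r M.
Proof.
move=> /convergentP[r r0 [M aM]] [s s0 [N bN]].
exists (Num.min r s); first by rewrite lt_min r0.
exists (Num.max M N); split => n; rewrite le_max.
  rewrite (abs_bound_le _ _ aM) ?ge_min ?lexx // ltW // lt_min r0 //.
by rewrite (abs_bound_le _ _ bN) ?ge_min ?lexx ?orbT // ltW // lt_min r0.
Qed.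

Lemma convergentD a b : convergent a -> convergent b ->
  convergent (fun j k => a j k + b j k).
Proof.
move=> ca cb; have [r r0 [M [aM bM]]] := convergent_bound ca cb.
apply/convergentP; exists r => //; exists (M + M) => n; apply: le_trans _ (lerD (aM n) (bM n)).
rewrite -dsumD; apply: ler_dsum => j k.
by rewrite -mulrDl ler_wpM2r ?ncD // exprn_ge0 // ltW.
Qed.

Lemma convergentZ (c : C) a : convergent a -> convergent (fun j k => c * a j k).
Proof.
move=> /convergentP[r r0 [M aM]]; apply/convergentP; exists r => //; exists (nc c * M) => n.
apply: le_trans _ (ler_wpM2l (nc_ge0 c) (aM n)); rewrite -dsumMl.
by apply: ler_dsum => j k; rewrite ncM mulrA.
Qed.

Lemma eq_convergent a b : (forall j k, a j k = b j k) ->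
  convergent a -> convergent b.
Proof.
move=> ab /convergentP[r r0 [M aM]]; apply/convergentP; exists r => //; exists M => n.
apply: le_trans _ (aM n); apply: ler_dsum => j k; by rewrite ab.
Qed.

Lemma convergentN a : convergent a -> convergent (fun j k => - a j k).
Proof. by move/(convergentZ (-1)); apply: eq_convergent => j k; rewrite mulN1r. Qed.

Lemma convergent0 : convergent (fun _ _ => 0 : C).
Proof.
exists 1 => //; exists 0 => n; rewrite big1 // => j _; rewrite big1 // => k _.
by rewrite nc0 mul0r.
Qed.

Lemma convergent_sum (I : Type) (s : seq I) (F : I -> dseries R) :
  (forall i, convergent (F i)) -> convergent (fun j k => \sum_(i <- s) F i j k).
Proof.
move=> cF; elim: s => [|i s IH].
  by apply: eq_convergent convergent0 => j k; rewrite big_nil.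
by apply: eq_convergent (convergentD (cF i) IH) => j k; rewrite big_cons.
Qed.

Lemma ds_evalD a b tau : convergent a -> convergent b ->
  \forall z \near (tau : C^o * C^o),
  ds_eval tau (fun j k => a j k + b j k) z = ds_eval tau a z + ds_eval tau b z.
Proof.
move=> /ds_eval_near-/(_ tau)[M1 h1] /ds_eval_near-/(_ tau)[M2 h2].
apply: filterS2 h1 h2 => z [h1 _] [h2 _]; apply: ds_eval_unique.
have -> : dsum (dterm (fun j k => a j k + b j k) (z.1 - tau.1, z.2 - tau.2)) =
  dsum (dterm a (z.1 - tau.1, z.2 - tau.2)) \+
  dsum (dterm b (z.1 - tau.1, z.2 - tau.2)).
  apply/funext => n /=; rewrite -dsumD; apply: eq_dsum => j k.
  by rewrite /dterm !mulrDl.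
exact: cvgCD h1 h2.
Qed.

Lemma ds_evalZ (c : C) a tau : convergent a ->
  \forall z \near (tau : C^o * C^o),
  ds_eval tau (fun j k => c * a j k) z = c * ds_eval tau a z.
Proof.
move=> /ds_eval_near-/(_ tau)[M1]; apply: filterS => z [h1 _].
apply: ds_eval_unique.
have -> : dsum (dterm (fun j k => c * a j k) (z.1 - tau.1, z.2 - tau.2)) =
  fun n => c * dsum (dterm a (z.1 - tau.1, z.2 - tau.2)) n.
  apply/funext => n /=; rewrite -dsumMl; apply: eq_dsum => j k.
  by rewrite /dterm !mulrA.
exact: cvgCMl h1.
Qed.

Lemma dterm_mul a b w j k :
  dterm (ds_mul a b) w j k = conv2 (dterm a w) (dterm b w) j k.
Proof.
rewrite /dterm /ds_mul /conv2 !mulr_suml; apply: eq_bigr => j' _.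
rewrite !mulr_suml; apply: eq_bigr => k' _.
have hj : (j' <= j)%N by rewrite -ltnS ltn_ord.
have hk : (k' <= k)%N by rewrite -ltnS ltn_ord.
have ej (x : C) : x ^+ j = x ^+ j' * x ^+ (j - j') by rewrite -exprD subnKC.
have ek (x : C) : x ^+ k = x ^+ k' * x ^+ (k - k') by rewrite -exprD subnKC.
rewrite ej ek; ring.
Qed.

Lemma abs_bound_mul a b (r M N : R) : 0 <= r -> abs_bound a r M ->
  abs_bound b r N -> abs_bound (ds_mul a b) r (M * N).
Proof.
move=> r0 aM bN n.
pose A (c : dseries R) j k := nc (c j k) * r ^+ (j + k).
have A0 c j k : 0 <= A c j k by rewrite mulr_ge0 ?nc_ge0 ?exprn_ge0.
apply: le_trans (_ : dsum (conv2 (A a) (A b)) n <= _).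
  apply: ler_dsum => j k; rewrite /ds_mul /conv2.
  apply: le_trans (ler_wpM2r _ (nc_sum _ _ _)) _; first exact: exprn_ge0.
  rewrite mulr_suml; apply: ler_sum => j' _.
  apply: le_trans (ler_wpM2r _ (nc_sum _ _ _)) _; first exact: exprn_ge0.
  rewrite mulr_suml; apply: ler_sum => k' _.
  have hj : (j' <= j)%N by rewrite -ltnS ltn_ord.
  have hk : (k' <= k)%N by rewrite -ltnS ltn_ord.
  have -> : r ^+ (j + k) = r ^+ (j' + k') * r ^+ (j - j' + (k - k')).
    by rewrite -exprD; congr (_ ^+ _); lia.
  by rewrite ncM /A mulrACA.
apply: le_trans (dsum_conv2_le _ (A0 a) (A0 b)) _.
by apply: ler_pM; rewrite ?dsum_ge0.
Qed.

Lemma convergentM a b : convergent a -> convergent b -> convergent (ds_mul a b).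
Proof.
move=> ca cb; have [r r0 [M [aM bM]]] := convergent_bound ca cb.
by apply/convergentP; exists r => //; exists (M * M); apply: abs_bound_mul => //; exact: ltW.
Qed.

Lemma ds_evalM a b tau : convergent a -> convergent b ->
  \forall z \near (tau : C^o * C^o),
  ds_eval tau (ds_mul a b) z = ds_eval tau a z * ds_eval tau b z.
Proof.
move=> ca cb; have [r r0 [M [aM bM]]] := convergent_bound ca cb.
apply: filterS (near_box tau r0) => z zr; apply: ds_eval_unique.
have -> : dsum (dterm (ds_mul a b) (z.1 - tau.1, z.2 - tau.2)) =
  dsum (conv2 (dterm a (z.1 - tau.1, z.2 - tau.2))
              (dterm b (z.1 - tau.1, z.2 - tau.2))).
  by apply/funext => n; apply: eq_dsum => j k; rewrite dterm_mul.
have [za _] := ds_eval_cvg aM zr; have [zb _] := ds_eval_cvg bM zr.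
case: zr => /ltW z1 /ltW z2.
by apply: (dsum_conv2_cvg _ _ aM bM za zb) => j k; exact: nc_dterm.
Qed.

Lemma taylor_out tau P j k : (size (translate tau P) <= j)%N ||
  (sizeY (translate tau P) <= k)%N -> taylor tau P j k = 0.
Proof.
rewrite /taylor => /orP[h|h].
  have -> : (translate tau P)`_j = 0 by exact: nth_default.
  by rewrite coef0.
by rewrite nth_default // (leq_trans (max_size_coefXY _ _)).
Qed.

Lemma taylor_convergent tau P : convergent (taylor tau P).
Proof.
pose m := maxn (size (translate tau P)) (sizeY (translate tau P)).
apply/convergentP; exists 1 => //.
exists (dsum (fun j k => nc (taylor tau P j k) * 1 ^+ (j + k)) m) => n.
have F0 j k : 0 <= nc (taylor tau P j k) * 1 ^+ (j + k).
  by rewrite expr1n mulr1 nc_ge0.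
case: (leqP n m) => nm; first exact: dsum_mono.
rewrite [leRHS](dsum_widen _ (ltnW nm)); apply: ler_dsum => j k.
case: ifP => // /negbT; rewrite negb_and -!leqNgt => h.
rewrite taylor_out ?nc0 ?mul0r //.
by move: h; rewrite !geq_max => /orP[/andP[-> //]|/andP[_ ->]]; rewrite orbT.
Qed.

(** The partial sums are eventually constant, so this holds at every [z] and not only near [tau]. *)
Lemma ds_eval_taylor tau P z : ds_eval tau (taylor tau P) z = ev P z.
Proof.
apply: ds_eval_unique.
apply/cvgC_ncP => e e0.
exists (maxn (size (translate tau P)) (sizeY (translate tau P))) => // n /=.
rewrite geq_max => /andP[n1 n2].
have -> : dsum (dterm (taylor tau P) (z.1 - tau.1, z.2 - tau.2)) n = ev P z.
  transitivity (ev (translate tau P) (z.1 - tau.1, z.2 - tau.2)).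
    by rewrite (ev_sum _ n1 n2).
  rewrite ev_translate /= [tau.1 + _]addrC [tau.2 + _]addrC !subrK.
  by case: (z).
by rewrite subrr nc0.
Qed.

End Evaluation.

(** * Termwise differentiation in z_1 *)

Section SeriesDerivative.
Variable R : realType.
Local Notation C := R[i].
Local Notation nc := (@ComplexField.Normc.normc R).
Implicit Types (a b : dseries R) (z tau : C * C) (P : {poly {poly C}}).

(** Induction on [j]: the remainder of order [j + 1] is [x] times that of order [j], plus
    [(x - y)^2 j y^(j-1)]. The factor [rho ^+ j / rho ^+ 2] stands for rho^(j-2) without truncated
    subtraction at [j = 0, 1]. *)
Lemma exp_second_order (x y : C) (rho : R) j : 0 < rho ->
  nc x <= rho -> nc y <= rho ->
  nc (x ^+ j - y ^+ j - (x - y) * (j%:R * y ^+ j.-1))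
    <= nc (x - y) ^+ 2 * (j%:R ^+ 2 * rho ^+ j / rho ^+ 2).
Proof.
move=> rho0 xr yr; elim: j => [|j IH].
  by rewrite !expr0 subrr mul0r mulr0 subr0 nc0 expr0n !mul0r mulr0.
have -> : x ^+ j.+1 - y ^+ j.+1 - (x - y) * (j.+1%:R * y ^+ j.+1.-1) =
   x * (x ^+ j - y ^+ j - (x - y) * (j%:R * y ^+ j.-1)) +
   (x - y) ^+ 2 * (j%:R * y ^+ j.-1).
  case: j {IH} => [|j]; first by rewrite !expr0 !expr1 /=; ring.
  by rewrite !exprS /= -natr1; ring.
apply: le_trans (ncD _ _) _; rewrite !ncM !ncX nc_nat -expr2.
have h1 : nc x * nc (x ^+ j - y ^+ j - (x - y) * (j%:R * y ^+ j.-1)) <=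
   rho * (nc (x - y) ^+ 2 * (j%:R ^+ 2 * rho ^+ j / rho ^+ 2)).
  by rewrite ler_pM ?nc_ge0.
have h2 : j%:R * nc y ^+ j.-1 <= j%:R * rho ^+ j.+1 / rho ^+ 2.
  case: j {IH h1} => [|j]; first by rewrite !mul0r.
  have -> : rho ^+ j.+2 = rho ^+ j * rho ^+ 2 by rewrite -exprD addn2.
  rewrite mulrA mulfK ?expf_neq0 ?gt_eqF // ler_wpM2l //.
  by rewrite lerXn2r // nnegrE ?nc_ge0 // ltW.
apply: le_trans (lerD h1 (ler_wpM2l (exprn_ge0 _ (nc_ge0 _)) h2)) _.
have -> : rho * (nc (x - y) ^+ 2 * (j%:R ^+ 2 * rho ^+ j / rho ^+ 2)) +
  nc (x - y) ^+ 2 * (j%:R * rho ^+ j.+1 / rho ^+ 2) =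
  nc (x - y) ^+ 2 * ((j%:R ^+ 2 + j%:R) * rho ^+ j.+1 / rho ^+ 2).
  by rewrite (exprS rho j); ring.
rewrite ler_wpM2l ?exprn_ge0 ?nc_ge0 //.
rewrite ler_wpM2r ?invr_ge0 ?exprn_ge0 ?(ltW rho0) // ler_wpM2r //.
  by rewrite exprn_ge0 ?(ltW rho0).
have : 0 <= j%:R :> R by []. rewrite -natr1; nra.
Qed.

(** For [j = 0] the factor [j%:R] vanishes, so the truncated [j.-1] is harmless. *)
Definition deriv_term a (w : C * C) : nat -> nat -> C :=
  fun j k => a j k * (j%:R * w.1 ^+ j.-1) * w.2 ^+ k.

Definition ds_deriv tau a z : C :=
  lim (dsum (deriv_term a (z.1 - tau.1, z.2 - tau.2)) @ \oo : set_system C^o).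

Lemma sqr_le_exp4 n : (n ^ 2 <= 4 ^ n)%N.
Proof. by rewrite -[4%N]/(2 ^ 2)%N -expnM mulnC expnM leq_sqr ltnW // ltn_expl. Qed.

Lemma ds_deriv_cvg a tau (r M : R) z : 0 < r -> abs_bound a r M ->
  box tau (r / 4) z ->
  (dsum (deriv_term a (z.1 - tau.1, z.2 - tau.2)) : nat -> C^o) @ \oo
    --> (ds_deriv tau a z : C^o) /\ nc (ds_deriv tau a z) <= M / (r / 4).
Proof.
move=> r0 aM [/ltW h1 /ltW h2].
have r40 : 0 < r / 4 by rewrite divr_gt0.
(* Since [j <= 4 ^ j], [j (r / 4)^(j-1)] is at most [r^j / (r / 4)]; the derived series thus has the
   majorant of [a] up to the factor [r / 4]. *)
have bnd j k : nc (deriv_term a (z.1 - tau.1, z.2 - tau.2) j k) <=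
    nc (a j k) * r ^+ (j + k) / (r / 4).
  rewrite /deriv_term /= !ncM !ncX nc_nat -!mulrA ler_wpM2l ?nc_ge0 //.
  rewrite exprD -mulrA [r ^+ k * _]mulrC !mulrA ler_pM ?exprn_ge0 ?nc_ge0 //.
    by rewrite mulr_ge0 ?exprn_ge0 ?nc_ge0.
    apply: le_trans (_ : j%:R * (r / 4) ^+ j.-1 <= _).
      by rewrite ler_wpM2l // lerXn2r // nnegrE ?nc_ge0 // ltW.
    rewrite ler_pdivlMr // -mulrA.
    case: j => [|j]; first by rewrite mul0r expr0.
    rewrite -exprSr /= exprMn exprVn mulrCA ler_piMr ?exprn_ge0 ?(ltW r0) //.
    by rewrite ler_pdivrMr ?exprn_gt0 // mul1r -natrX ler_nat ltnW // ltn_expl.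
  rewrite lerXn2r // ?nnegrE ?nc_ge0 // ?(ltW r0) // (le_trans h2) //.
  by rewrite ler_pdivrMr // ler_peMr ?ltW // ltr1n.
have bM n : dsum (fun j k => nc (a j k) * r ^+ (j + k) / (r / 4)) n <= M / (r / 4).
  by rewrite dsumMr ler_wpM2r // invr_ge0 ltW.
have [l al lM] := dsum_cvg bnd bM.
by have -> : ds_deriv tau a z = l by exact: cvg_lim al.
Qed.

(* Dividing the radius by 4 absorbs the factor j^2 <= 4^j of the second-order
   remainder of w^j. *)
Lemma is_derive_ds_eval a tau (r M : R) z : 0 < r -> abs_bound a r M ->
  box tau (r / 4) z ->
  is_derive (z.1 : C^o) (1 : C^o) (fun w : C^o => ds_eval tau a (w, z.2) : C^o)
    (ds_deriv tau a z).
Proof.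
move=> r0 aM zr; have [h1 h2] := zr.
have r40 : 0 < r / 4 by rewrite divr_gt0.
have r4r : r / 4 <= r by rewrite ler_pdivrMr // ler_peMr ?ltW // ltr1n.
have [dz _] := ds_deriv_cvg r0 aM zr.
apply: (@is_derive_quadratic _ _ _ _ (M / (r / 4) ^+ 2)
          (r / 4 - nc (z.1 - tau.1))); first by rewrite subr_gt0.
move=> h; rewrite ltrBrDr => hr.
have hzr : box tau (r / 4) (h + z.1, z.2).
  by split => //=; rewrite -addrA (le_lt_trans (ncD _ _)).
have [za _] := ds_eval_cvg aM (sub_box r4r zr).
have [ha _] := ds_eval_cvg aM (sub_box r4r hzr).
pose w2 := z.2 - tau.2; pose y := z.1 - tau.1; pose x := h + z.1 - tau.1.
have hxy : h = x - y by rewrite /x /y; ring.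
(* [F] collects the second-order remainders of the single terms; its sum is the remainder that
   [is_derive_quadratic] asks for. *)
pose F j k := a j k * (x ^+ j - y ^+ j - (x - y) * (j%:R * y ^+ j.-1)) * w2 ^+ k.
have Fl : (dsum F : nat -> C^o) @ \oo -->
   (ds_eval tau a (h + z.1, z.2) - ds_eval tau a z - h * ds_deriv tau a z : C^o).
  have -> : dsum F = fun n => dsum (dterm a (x, w2)) n - dsum (dterm a (y, w2)) n
     - h * dsum (deriv_term a (y, w2)) n.
    apply/funext => n; rewrite -dsumMl -!dsumN -!dsumD; apply: eq_dsum => j k.
    rewrite /F /dterm /deriv_term /= -hxy; ring.
  exact: (cvgCB (cvgCB ha za) (cvgCMl (c := h) dz)).
case: (z) Fl => z1 z2 Fl.
apply: (nc_cvg_le Fl); apply: nearW => n.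
apply: le_trans (_ : dsum (fun j k => nc h ^+ 2 / (r / 4) ^+ 2 *
     (nc (a j k) * r ^+ (j + k))) n <= _).
  apply: nc_dsum => j k; rewrite !ncM ncX.
  have xr : nc x <= r / 4 by case: hzr => /ltW.
  have := exp_second_order j r40 xr (ltW h1); rewrite -hxy => so.
  rewrite -mulrA [leRHS]mulrCA ler_wpM2l ?nc_ge0 //.
  have wk : nc w2 ^+ k <= r ^+ k.
    by rewrite lerXn2r // ?nnegrE ?nc_ge0 ?(ltW r0) // (le_trans (ltW h2)).
  apply: le_trans (ler_pM (nc_ge0 _) (exprn_ge0 _ (nc_ge0 _)) so wk) _.
  have jr : j%:R ^+ 2 * (r / 4) ^+ j <= r ^+ j.
    rewrite exprMn exprVn mulrCA ler_piMr ?exprn_ge0 ?(ltW r0) //.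
    by rewrite ler_pdivrMr ?exprn_gt0 // mul1r -!natrX ler_nat sqr_le_exp4.
  set c := nc h ^+ 2; set d := (r / 4) ^+ 2.
  have -> : c * (j%:R ^+ 2 * (r / 4) ^+ j / d) * r ^+ k =
     c / d * r ^+ k * (j%:R ^+ 2 * (r / 4) ^+ j) by ring.
  have -> : c / d * r ^+ (j + k) = c / d * r ^+ k * r ^+ j by rewrite exprD; ring.
  rewrite ler_wpM2l // mulr_ge0 ?exprn_ge0 ?(ltW r0) // mulr_ge0 ?exprn_ge0 ?nc_ge0 //.
  by rewrite invr_ge0 exprn_ge0 ?(ltW r40).
rewrite dsumMl [leRHS]mulrC mulrA mulrAC ler_wpM2r //.
  by rewrite invr_ge0 exprn_ge0 ?(ltW r40).
by rewrite ler_wpM2l ?exprn_ge0 ?nc_ge0.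
Qed.

End SeriesDerivative.

(** * Local integrability on the torus *)

Section ComplexMeasurable.
Variable R : realType.
Local Notation C := R[i].
Local Notation nc := (@ComplexField.Normc.normc R).
Local Notation T2 := (measurableTypeR R * measurableTypeR R)%type.
Implicit Types (D : set T2) (f g : T2 -> C).

(** The form in which [Lp_loc] states measurability. *)
Definition cmeas D f : Prop :=
  measurable_fun D (fun t => complex.Re (f t)) /\
  measurable_fun D (fun t => complex.Im (f t)).

Lemma cmeas_cst D (c : C) : cmeas D (fun _ => c).
Proof. by split; exact: measurable_cst. Qed.

Lemma cmeasD D f g : cmeas D f -> cmeas D g -> cmeas D (fun t => f t + g t).
Proof.
move=> [fr fi] [gr gi]; split.
  by under eq_fun do rewrite ReD; exact: measurable_funD.
by under eq_fun do rewrite ImD; exact: measurable_funD.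
Qed.

Lemma cmeasM D f g : cmeas D f -> cmeas D g -> cmeas D (fun t => f t * g t).
Proof.
move=> [fr fi] [gr gi]; split.
  under eq_fun do rewrite ReM.
  by apply: measurable_funB; exact: measurable_funM.
under eq_fun do rewrite ImM.
by apply: measurable_funD; exact: measurable_funM.
Qed.

Lemma cmeasX D f n : cmeas D f -> cmeas D (fun t => f t ^+ n).
Proof.
move=> cf; elim: n => [|n IH]; first exact: cmeas_cst.
by under eq_fun do rewrite exprS; exact: cmeasM.
Qed.

Lemma cmeasV D f : cmeas D f -> cmeas D (fun t => (f t)^-1).
Proof.
move=> [fr fi].
pose n2 t := complex.Re (f t) ^+ 2 + complex.Im (f t) ^+ 2.
have mn : measurable_fun D (fun t => (n2 t)^-1).
  have -> : (fun t => (n2 t)^-1) = (@powR R ^~ (-1)) \o n2.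
    (* [powR] with exponent -1 is measurable and agrees with the inverse on nonnegative reals, 0
       included. *)
    by apply/funext => t /=; rewrite powR_inv1 // addr_ge0 ?sqr_ge0.
  apply: measurableT_comp; first exact: measurable_powR.
  by apply: measurable_funD; exact: measurable_funX.
split.
  have -> : (fun t => complex.Re (f t)^-1) =
      (fun t => complex.Re (f t) * (n2 t)^-1).
    by apply/funext => t; rewrite /n2; case: (f t).
  exact: measurable_funM.
have -> : (fun t => complex.Im (f t)^-1) =
    (fun t => - (complex.Im (f t) * (n2 t)^-1)).
  by apply/funext => t; rewrite /n2; case: (f t).
by apply: measurable_funN; exact: measurable_funM.
Qed.

Lemma cmeas_sum (I : Type) (s : seq I) D (F : I -> T2 -> C) :
  (forall i, cmeas D (F i)) -> cmeas D (fun t => \sum_(i <- s) F i t).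
Proof.
move=> cF; elim: s => [|i s IH].
  by under eq_fun do rewrite big_nil; exact: cmeas_cst.
by under eq_fun do rewrite big_cons; exact: cmeasD.
Qed.

Lemma cmeas_cvg D (h : nat -> T2 -> C) f : (forall n, cmeas D (h n)) ->
  (forall t, D t -> (h ^~ t : nat -> C^o) @ \oo --> (f t : C^o)) -> cmeas D f.
Proof.
move=> mh hf; split.
  apply: (@measurable_fun_cvg _ _ _ _ (fun n t => complex.Re (h n t))).
    by move=> n; case: (mh n).
  by move=> t /hf/cvgC_ReIm[].
apply: (@measurable_fun_cvg _ _ _ _ (fun n t => complex.Im (h n t))).
  by move=> n; case: (mh n).
by move=> t /hf/cvgC_ReIm[].
Qed.

Lemma cmeasS D D' f : measurable D -> D' `<=` D -> cmeas D f -> cmeas D' f.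
Proof. by move=> mD DD [fr fi]; split; apply: measurable_funS; eauto. Qed.

Lemma eq_cmeas D f g : (forall t, D t -> f t = g t) -> cmeas D f -> cmeas D g.
Proof.
move=> fg [fr fi]; split.
  by apply: eq_measurable_fun fr => t; rewrite inE => /fg ->.
by apply: eq_measurable_fun fi => t; rewrite inE => /fg ->.
Qed.

Lemma cmeas_nc D f : cmeas D f -> measurable_fun D (fun t => nc (f t)).
Proof.
move=> [fr fi]; under eq_fun do rewrite nc_def.
apply: (@measurableT_comp _ _ _ _ _ _ (@Num.sqrt R)).
  by apply: continuous_measurable_fun; exact: sqrt_continuous.
by apply: measurable_funD; exact: measurable_funX.
Qed.

Lemma measurable_nc_powR D f (s : R) : cmeas D f ->
  measurable_fun D (fun t => (nc (f t) `^ s)%:E).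
Proof.
move=> cf; apply/measurable_EFinP.
by apply: (@measurableT_comp _ _ _ _ _ _ (@powR R ^~ s)) => //; exact: cmeas_nc.
Qed.

End ComplexMeasurable.

(** * The torus in angular coordinates *)

Section Torus.
Variable R : realType.
Local Notation C := R[i].
Local Notation nc := (@ComplexField.Normc.normc R).
Local Notation T2 := (measurableTypeR R * measurableTypeR R)%type.
Implicit Types (D : set T2) (f g : C * C -> C) (tau z : C * C).

Lemma torus_nc1 (t : T2) : nc (torus_pt t).1 = 1.
Proof. by rewrite nc_def /= cos2Dsin2 sqrtr1. Qed.

Lemma torus_nc2 (t : T2) : nc (torus_pt t).2 = 1.
Proof. by rewrite nc_def /= cos2Dsin2 sqrtr1. Qed.

Lemma cmeas_torus1 D : cmeas D (fun t => (torus_pt t).1).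
Proof.
have m1 : measurable_fun D (@fst _ _ : T2 -> measurableTypeR R).
  by apply: measurable_funTS; exact: measurable_fst.
split; apply: (measurableT_comp _ m1); apply: continuous_measurable_fun.
  exact: continuous_cos.
exact: continuous_sin.
Qed.

Lemma cmeas_torus2 D : cmeas D (fun t => (torus_pt t).2).
Proof.
have m2 : measurable_fun D (@snd _ _ : T2 -> measurableTypeR R).
  by apply: measurable_funTS; exact: measurable_snd.
split; apply: (measurableT_comp _ m2); apply: continuous_measurable_fun.
  exact: continuous_cos.
exact: continuous_sin.
Qed.

Lemma cmeas_ev D (P : {poly {poly C}}) : cmeas D (fun t => ev P (torus_pt t)).
Proof.
have -> : (fun t => ev P (torus_pt t)) = fun t =>
    \sum_(j < size P) \sum_(k < sizeY P)
      P`_j`_k * (torus_pt t).1 ^+ j * (torus_pt t).2 ^+ k.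
  by apply/funext => t; rewrite -ev_sum.
apply: cmeas_sum => j; apply: cmeas_sum => k.
apply: cmeasM; last exact/cmeasX/cmeas_torus2.
by apply: cmeasM; [exact: cmeas_cst|exact/cmeasX/cmeas_torus1].
Qed.

Lemma torus_pt_open (V : set (C^o * C^o)) : open V ->
  forall t : T2, V (torus_pt t) -> exists2 d : R, 0 < d &
  forall u : T2, `|t.1 - u.1| < d -> `|t.2 - u.2| < d -> V (torus_pt u).
Proof.
rewrite openE => Vo t /Vo /nbhs_boxP[r r0 rV].
have r20 : 0 < r / 2 by rewrite divr_gt0.
have one (x : R) : exists2 d : R, 0 < d & forall y : R, `|x - y| < d ->
    nc ((cos y +i* sin y) - (cos x +i* sin x)) < r.
  have /cvgrPdist_lt/(_ _ r20)/nbhs_ballP[d1 d10 h1] := @continuous_cos R x.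
  have /cvgrPdist_lt/(_ _ r20)/nbhs_ballP[d2 d20 h2] := @continuous_sin R x.
  exists (Num.min d1 d2); first by rewrite lt_min d10.
  move=> y; rewrite lt_min => /andP[/h1 y1 /h2 y2].
  apply: le_lt_trans (ler_nc_ReIm _) _; rewrite /= [ltRHS]splitr.
  by rewrite ltrD // distrC.
have [d1 d10 h1] := one t.1; have [d2 d20 h2] := one t.2.
exists (Num.min d1 d2); first by rewrite lt_min d10.
move=> u; rewrite !lt_min => /andP[u1 _] /andP[_ u2].
by apply: rV; split => /=; [exact: h1|exact: h2].
Qed.

(** The product sigma-algebra is generated by rectangles, so the open set of angles is written as a
    countable union of rational squares. *)
Lemma measurable_torus_preimage (V : set (C^o * C^o)) : open V ->
  measurable (@torus_pt R @^-1` V : set T2).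
Proof.
move=> Vo.
pose B (a b c : rat) : set T2 := ball (ratr a : R) (ratr c : R) `*`
   ball (ratr b : R) (ratr c : R).
pose F a b c : set T2 := if pselect (B a b c `<=` @torus_pt R @^-1` V) then B a b c else set0.
have -> : @torus_pt R @^-1` V = \bigcup_a \bigcup_b \bigcup_c F a b c.
  apply/seteqP; split => t; last first.
    move=> [a _ [b _ [c _]]]; rewrite /F; case: pselect => //= h; exact: h.
  move=> /(torus_pt_open Vo)[d d0 dV].
  (* A rational [c] below [d / 2]: a ball of radius [c] whose centre is within [c] of [t] stays
     within [2 c < d] of [t]. The lower bound [d / 4] only keeps [c] positive. *)
  have d42 : d / 4 < d / 2.
    by rewrite ltr_pM2l // ltf_pV2 ?posrE // ltr_nat.
  have [c] := rat_in_itvoo d42; rewrite in_itv /= => /andP[c1 c2].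
  have c0 : 0 < ratr c :> R by apply: lt_trans c1; rewrite divr_gt0.
  have near (x : R) : exists a : rat, `|ratr a - x| < ratr c.
    have xc : x < x + ratr c by rewrite ltrDl.
    have [a] := rat_in_itvoo xc.
    rewrite in_itv /= => /andP[a1 a2]; exists a.
    by rewrite gtr0_norm ?subr_gt0 // ltrBlDr addrC.
  have [a at1] := near t.1; have [b bt2] := near t.2.
  exists a => //; exists b => //; exists c => //; rewrite /F.
  case: pselect => [h|nB]; first by split.
  exfalso; apply: nB => u [u1 u2] /=; apply: dV.
    apply: le_lt_trans (ler_distD (ratr a) _ _) _.
    by rewrite distrC; move: u1 c2; rewrite /ball /=; lra.
  apply: le_lt_trans (ler_distD (ratr b) _ _) _.
  by rewrite distrC; move: u2 c2; rewrite /ball /=; lra.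
apply: bigcupT_measurable_rat => a; apply: bigcupT_measurable_rat => b.
apply: bigcupT_measurable_rat => c; rewrite /F; case: pselect => h; last exact: measurable0.
by apply: measurableX; exact: measurable_ball.
Qed.

Lemma measurable_torus_angles (V : set (C^o * C^o)) : open V ->
  measurable (torus_angles V).
Proof.
move=> Vo; apply: measurableI; last exact: measurable_torus_preimage.
by apply: measurableX; exact: measurable_itv.
Qed.

Local Notation mu2 := (@lebesgue_measure R \x @lebesgue_measure R)%E.

Lemma torus_angles_finite (V : set (C^o * C^o)) : open V ->
  (mu2 (torus_angles V) < +oo)%E.
Proof.
move=> Vo; pose S : set T2 := `]- pi, pi] `*` `]- pi, pi].
have h : (mu2 (torus_angles V) <= mu2 S)%E.
  apply: le_measure; rewrite ?inE; last exact: subIsetl.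
    exact: measurable_torus_angles.
  by apply: measurableX; exact: measurable_itv.
apply: le_lt_trans h _.
rewrite product_measure1E //=.
rewrite !lebesgue_measure_itv /=; case: ifP => _; last by rewrite mul0e ltry.
by rewrite -EFinB -EFinM ltry.
Qed.

End Torus.

(** * Comparison of functions in local L^s *)

Section LocalIntegrability.
Variable R : realType.
Local Notation C := R[i].
Local Notation nc := (@ComplexField.Normc.normc R).
Local Notation T2 := (measurableTypeR R * measurableTypeR R)%type.
Local Notation mu2 := (@lebesgue_measure R \x @lebesgue_measure R)%E.
Local Notation tbox tau r := (torus_angles (box tau r)).
Implicit Types (D : set T2) (f g h : C * C -> C) (tau z : C * C) (s r : R).

Definition cmeas_near tau f := exists2 r, 0 < r &
  cmeas (tbox tau r) (fun t => f (torus_pt t)).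

Lemma sub_torus_angles (V W : set (C^o * C^o)) : V `<=` W ->
  torus_angles V `<=` torus_angles W.
Proof. by move=> VW t [? /VW]. Qed.

Lemma measurable_tbox tau r : 0 < r -> measurable (tbox tau r).
Proof. by move=> r0; apply: measurable_torus_angles; exact: open_box. Qed.

Lemma sub_tbox tau r r' : r <= r' -> tbox tau r `<=` tbox tau r'.
Proof. by move=> rr; apply: sub_torus_angles; exact: sub_box. Qed.

Lemma nc_powR_ge0 f s (t : T2) : (0 <= (nc (f (torus_pt t)) `^ s)%:E)%E.
Proof. by rewrite lee_fin powR_ge0. Qed.

Lemma Lp_loc_tbox s tau f : Lp_loc s tau f <-> exists2 r, 0 < r &
  cmeas (tbox tau r) (fun t => f (torus_pt t)) /\
  (\int[mu2]_(t in tbox tau r) (nc (f (torus_pt t)) `^ s)%:E < +oo)%E.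
Proof.
split=> [[V [Vo Vt mr mi fin]]|[r r0 [[mr mi] fin]]]; last first.
  exists (box tau r); split => //; first exact: open_box.
  exact: box_center.
have [r r0 rV] := (nbhs_boxP tau V).1 (open_nbhs_nbhs (conj Vo Vt)).
have mV := measurable_torus_angles Vo.
exists r => //; split.
  exact: (cmeasS mV (sub_torus_angles rV)).
apply: le_lt_trans fin; apply: ge0_subset_integral => //.
- exact: measurable_tbox.
- exact: measurable_nc_powR.
- by move=> t _; exact: nc_powR_ge0.
- exact: sub_torus_angles.
Qed.

Lemma Lp_loc_shrink s tau f r : 0 < r -> Lp_loc s tau f ->
  exists2 r', 0 < r' <= r &
  cmeas (tbox tau r') (fun t => f (torus_pt t)) /\
  (\int[mu2]_(t in tbox tau r') (nc (f (torus_pt t)) `^ s)%:E < +oo)%E.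
Proof.
move=> r0 /Lp_loc_tbox[r1 r10 [mf fin]].
have r20 : 0 < Num.min r r1 by rewrite lt_min r0.
have r21 : Num.min r r1 <= r1 by rewrite ge_min lexx orbT.
exists (Num.min r r1); first by rewrite r20 ge_min lexx.
split.
  by apply: cmeasS mf; [exact: measurable_tbox|exact: sub_tbox].
apply: le_lt_trans fin; apply: ge0_subset_integral => //.
- exact: measurable_tbox.
- exact: measurable_tbox.
- exact: measurable_nc_powR.
- by move=> t _; exact: nc_powR_ge0.
- exact: sub_tbox.
Qed.

Lemma cmeas_near_shrink tau f r : 0 < r -> cmeas_near tau f ->
  exists2 r', 0 < r' <= r & cmeas (tbox tau r') (fun t => f (torus_pt t)).
Proof.
move=> r0 [r1 r10 mf].
have r20 : 0 < Num.min r r1 by rewrite lt_min r0.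
have r21 : Num.min r r1 <= r1 by rewrite ge_min lexx orbT.
exists (Num.min r r1); first by rewrite r20 ge_min lexx.
by apply: cmeasS mf; [exact: measurable_tbox|exact: sub_tbox].
Qed.

Lemma Lp_loc_cmeas s tau f : Lp_loc s tau f -> cmeas_near tau f.
Proof. by move=> /Lp_loc_tbox[r r0 [mf _]]; exists r. Qed.

(** Estimates that rest on |p~| = |p| hold at points of the torus only. *)
Definition near_torus tau (P : C * C -> Prop) :=
  \forall z \near (tau : C^o * C^o), nc z.1 = 1 -> nc z.2 = 1 -> P z.

Lemma near_torus_tbox tau (P : C * C -> Prop) : near_torus tau P ->
  exists2 r, 0 < r & forall t, tbox tau r t -> P (torus_pt t).
Proof.
move=> /nbhs_boxP[r r0 h]; exists r => // t [_ /h]; apply.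
  exact: torus_nc1.
exact: torus_nc2.
Qed.

Lemma near_torusI tau (P Q : C * C -> Prop) : near_torus tau P ->
  near_torus tau Q -> near_torus tau (fun z => P z /\ Q z).
Proof.
by rewrite /near_torus => hP hQ; apply: filterS2 hP hQ => z hP hQ z1 z2; split; [exact: hP|exact: hQ].
Qed.

Lemma near_torus_sub tau (P Q : C * C -> Prop) : (forall z, P z -> Q z) ->
  near_torus tau P -> near_torus tau Q.
Proof.
by move=> PQ; rewrite /near_torus; apply: filterS => z hP z1 z2; exact/PQ/hP.
Qed.

Lemma near_torus_imp tau (P Q : C * C -> Prop) :
  (forall z, nc z.1 = 1 -> nc z.2 = 1 -> P z -> Q z) ->
  near_torus tau P -> near_torus tau Q.
Proof.
move=> PQ; rewrite /near_torus; apply: filterS => z hP z1 z2.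
exact: PQ (hP z1 z2).
Qed.

Lemma near_near_torus tau (P : C * C -> Prop) :
  (\forall z \near (tau : C^o * C^o), P z) -> near_torus tau P.
Proof. by rewrite /near_torus; apply: filterS. Qed.

Lemma near_torusT tau (P : C * C -> Prop) : (forall z, P z) -> near_torus tau P.
Proof. by move=> h; apply/nbhs_boxP; exists 1 => // z _ _ _. Qed.

(** Two majorants, each with its own exponent, so that one comparison covers sums, smaller exponents
    and a change of value at [tau]. *)
Lemma Lp_loc_dominated s s1 s2 (K : R) tau f g1 g2 : 0 <= K ->
  cmeas_near tau f -> Lp_loc s1 tau g1 -> Lp_loc s2 tau g2 ->
  near_torus tau (fun z => nc (f z) `^ s <= K * (nc (g1 z) `^ s1 + nc (g2 z) `^ s2)) ->
  Lp_loc s tau f.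
Proof.
move=> K0 mf l1 l2 /near_torus_tbox[r0 r00 dom].
have [r1 /andP[r10 r1r] m1] := cmeas_near_shrink r00 mf.
have [r2 /andP[r20 r2r] [mg1 i1]] := Lp_loc_shrink r10 l1.
have [r /andP[rp rr] [mg2 i2]] := Lp_loc_shrink r20 l2.
have mB := measurable_tbox tau rp.
have mf' : cmeas (tbox tau r) (fun t => f (torus_pt t)).
  apply: cmeasS m1; first exact: measurable_tbox.
  by apply: sub_tbox; exact: le_trans rr r2r.
have mg1' : cmeas (tbox tau r) (fun t => g1 (torus_pt t)).
  by apply: cmeasS mg1; [exact: measurable_tbox|exact: sub_tbox].
have i1' : (\int[mu2]_(t in tbox tau r) (nc (g1 (torus_pt t)) `^ s1)%:E < +oo)%E.
  apply: le_lt_trans i1; apply: ge0_subset_integral => //.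
  - exact: measurable_tbox.
  - exact: measurable_nc_powR.
  - by move=> t _; exact: nc_powR_ge0.
  - exact: sub_tbox.
apply/Lp_loc_tbox; exists r; first exact: rp.
split; first exact: mf'.
apply: (@le_lt_trans _ _ (\int[mu2]_(t in tbox tau r) (K%:E *
   ((nc (g1 (torus_pt t)) `^ s1)%:E + (nc (g2 (torus_pt t)) `^ s2)%:E)))%E).
  apply: ge0_le_integral => //.
  - by move=> t _; exact: nc_powR_ge0.
  - exact: measurable_nc_powR.
  - apply: measurable_funeM.
    by apply: emeasurable_funD; exact: measurable_nc_powR.
  - move=> t tr; rewrite -EFinD -EFinM lee_fin; apply: dom.
    by apply: sub_tbox tr; exact: le_trans (le_trans rr r2r) r1r.
rewrite ge0_integralZl_EFin //; last 2 first.
  by move=> t _; rewrite adde_ge0 // nc_powR_ge0.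
  by apply: emeasurable_funD; exact: measurable_nc_powR.
rewrite ge0_integralD //; last 4 first.
  by move=> t _; exact: nc_powR_ge0.
  exact: measurable_nc_powR.
  by move=> t _; exact: nc_powR_ge0.
  exact: measurable_nc_powR.
apply: lte_mul_pinfty; rewrite ?lee_fin //.
by apply: lte_add_pinfty; [exact: i1'|exact: i2].
Qed.

Lemma Lp_loc_cst s tau (c : C) : Lp_loc s tau (fun _ => c).
Proof.
apply/Lp_loc_tbox; exists 1 => //; split; first exact: cmeas_cst.
rewrite integral_cst; last exact: measurable_tbox.
rewrite lte_mul_pinfty ?lee_fin ?powR_ge0 //.
by apply: torus_angles_finite; exact: open_box.
Qed.

Lemma Lp_loc_le s (K : R) tau f g : 0 < s -> 0 <= K -> cmeas_near tau f ->
  Lp_loc s tau g -> near_torus tau (fun z => nc (f z) <= K * nc (g z)) ->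
  Lp_loc s tau f.
Proof.
move=> s0 K0 mf lg fg.
apply: (Lp_loc_dominated (powR_ge0 K s) mf lg lg).
apply: near_torus_sub fg => z zfg.
apply: le_trans (_ : (K * nc (g z)) `^ s <= _).
  by apply: ge0_ler_powR zfg; rewrite ?nnegrE ?mulr_ge0 ?nc_ge0 // ltW.
by rewrite powRM ?nc_ge0 // ler_wpM2l ?powR_ge0 // lerDl powR_ge0.
Qed.

Lemma Lp_loc_bounded s (K : R) tau f : 0 < s -> cmeas_near tau f ->
  near_torus tau (fun z => nc (f z) <= K) -> Lp_loc s tau f.
Proof.
move=> s0 mf fK; apply: (Lp_loc_le s0 (normr_ge0 K) mf (Lp_loc_cst s tau 1)).
apply: near_torus_sub fK => z zK; rewrite nc1 mulr1.
exact: le_trans (ler_norm _).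
Qed.

Lemma cmeas_near2 tau f g (op : C -> C -> C) :
  (forall D (F G : T2 -> C), cmeas D F -> cmeas D G ->
      cmeas D (fun t => op (F t) (G t))) ->
  cmeas_near tau f -> cmeas_near tau g -> cmeas_near tau (fun z => op (f z) (g z)).
Proof.
move=> hop [r r0 mf] /(cmeas_near_shrink r0)[r' /andP[r'0 rr] mg].
exists r' => //; apply: hop mg.
by apply: cmeasS mf; [exact: measurable_tbox|exact: sub_tbox].
Qed.

Lemma cmeas_nearD tau f g : cmeas_near tau f -> cmeas_near tau g ->
  cmeas_near tau (fun z => f z + g z).
Proof. by apply: cmeas_near2 => D F G; exact: cmeasD. Qed.

Lemma cmeas_nearM tau f g : cmeas_near tau f -> cmeas_near tau g ->
  cmeas_near tau (fun z => f z * g z).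
Proof. by apply: cmeas_near2 => D F G; exact: cmeasM. Qed.

Lemma cmeas_near_ev tau (P : {poly {poly C}}) : cmeas_near tau (ev P).
Proof. by exists 1 => //; exact: cmeas_ev. Qed.

Lemma cmeas_nearV tau f : cmeas_near tau f -> cmeas_near tau (fun z => (f z)^-1).
Proof. by move=> [r r0 mf]; exists r => //; exact: cmeasV. Qed.

Lemma cmeas_near_cst tau (c : C) : cmeas_near tau (fun _ => c).
Proof. by exists 1 => //; exact: cmeas_cst. Qed.

Lemma Lp_locD s tau f g : 0 < s -> Lp_loc s tau f -> Lp_loc s tau g ->
  Lp_loc s tau (fun z => f z + g z).
Proof.
move=> s0 lf lg.
apply: (Lp_loc_dominated (powR_ge0 2 s) _ lf lg).
  exact: cmeas_nearD (Lp_loc_cmeas lf) (Lp_loc_cmeas lg).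
apply: near_torusT => z.
set a := nc (f z); set b := nc (g z).
have a0 : 0 <= a := nc_ge0 _; have b0 : 0 <= b := nc_ge0 _.
(* Valid for every [s > 0], below 1 as well; the power of the maximum is then at most the sum of the
   two powers. *)
apply: le_trans (_ : (2 * Num.max a b) `^ s <= _).
  apply: ge0_ler_powR; rewrite ?nnegrE ?nc_ge0 ?mulr_ge0 ?le_max ?a0 // ?(ltW s0) //.
  apply: le_trans (ncD _ _) _; rewrite mulrDl !mul1r.
  by rewrite lerD // le_max lexx ?orbT.
rewrite powRM ?le_max ?a0 // ler_wpM2l ?powR_ge0 //.
by rewrite /Num.max; case: ifP => _; rewrite ?lerDl ?lerDr powR_ge0.
Qed.

Lemma Lp_locZ s tau (c : C) f : 0 < s -> Lp_loc s tau f ->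
  Lp_loc s tau (fun z => c * f z).
Proof.
move=> s0 lf; apply: (Lp_loc_le s0 (nc_ge0 c) _ lf).
  exact: cmeas_nearM (cmeas_near_cst tau c) (Lp_loc_cmeas lf).
by apply: near_torusT => z; rewrite ncM.
Qed.

(** [|f|^s' <= |f|^s + 1], and constants are integrable because the box has finite measure. *)
Lemma Lp_loc_mono s s' tau f : 0 < s' -> s' <= s -> Lp_loc s tau f ->
  Lp_loc s' tau f.
Proof.
move=> s0 ss lf.
apply: (Lp_loc_dominated ler01 (Lp_loc_cmeas lf) lf (Lp_loc_cst 1 tau 1)).
apply: near_torusT => z; rewrite mul1r nc1 powR1.
have [f1|f1] := leP 1 (nc (f z)).
  by apply: le_trans (_ : nc (f z) `^ s <= _); rewrite ?lerDl ?ler_powR.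
apply: le_trans (_ : 1 <= _); last by rewrite lerDr powR_ge0.
have -> : 1 = 1 `^ s' :> R by rewrite powR1.
by apply: ge0_ler_powR; rewrite ?nnegrE ?nc_ge0 // ltW.
Qed.

(** The fibre of [torus_pt] over [tau] is the zero set of the measurable function [d]. On it [g] is
    constant, and off it [g] agrees with [f]. *)
Lemma cmeas_near_eq tau f g :
  near_torus tau (fun z => z <> tau -> f z = g z) ->
  cmeas_near tau f -> cmeas_near tau g.
Proof.
move=> /near_torus_tbox[r0 r00 fg] /(cmeas_near_shrink r00)[r /andP[rp rr] mf].
exists r => //.
have mB := measurable_tbox tau rp.
pose d (t : T2) := nc ((torus_pt t).1 - tau.1) + nc ((torus_pt t).2 - tau.2).
have md : measurable_fun (tbox tau r) d.
  apply: measurable_funD; apply: cmeas_nc; apply: cmeasD.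
  - exact: cmeas_torus1.
  - exact: cmeas_cst.
  - exact: cmeas_torus2.
  - exact: cmeas_cst.
have dP t : d t = 0 <-> torus_pt t = tau.
  split=> [|tt]; last by rewrite /d tt !subrr !nc0 addr0.
  move/eqP; rewrite /d paddr_eq0 ?nc_ge0 // !nc_eq0 !subr_eq0.
  by case: (torus_pt t) (tau) => a b [c e] /= /andP[/eqP -> /eqP ->].
have mE : measurable (tbox tau r `&` d @^-1` [set 0]) by exact: md.
have mE' : measurable (tbox tau r `\` d @^-1` [set 0]).
  rewrite (_ : _ `\` _ = tbox tau r `\` (tbox tau r `&` d @^-1` [set 0])).
    exact: measurableD.
  by rewrite setDIr setDv set0U.
have cE : cmeas (tbox tau r `&` d @^-1` [set 0]) (fun t => g (torus_pt t)).
  apply: (@eq_cmeas _ _ (fun=> g tau)); last exact: cmeas_cst.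
  by move=> t [_ /= /dP ->].
have cE' : cmeas (tbox tau r `\` d @^-1` [set 0]) (fun t => g (torus_pt t)).
  apply: (@eq_cmeas _ _ (fun t => f (torus_pt t))).
    move=> t [tr /= dt]; apply: fg; first exact: sub_tbox tr.
    by move=> /dP.
  by apply: cmeasS mf => // t [].
rewrite -(setUIDK (tbox tau r) (d @^-1` [set 0])).
case: cE cE' => [a b] [c e].
by split; apply/measurable_funU.
Qed.

(* The value at tau is irrelevant: g o torus_pt is constant on the fibre over tau,
   so neither measurability nor finiteness of the integral depends on it. *)
Lemma Lp_loc_eq s tau f g : near_torus tau (fun z => z <> tau -> f z = g z) ->
  Lp_loc s tau f -> Lp_loc s tau g.
Proof.
move=> fg lf.
apply: (Lp_loc_dominated ler01 (cmeas_near_eq fg (Lp_loc_cmeas lf)) lf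
         (Lp_loc_cst s tau (g tau))).
apply: near_torus_sub fg => z; have [->|/eqP zt] := eqVneq z tau.
  by rewrite mul1r lerDr powR_ge0.
by move/(_ zt) ->; rewrite mul1r lerDl powR_ge0.
Qed.

Lemma Lp_isup s tau f : 0 < s -> Lp_loc s tau f ->
  (s%:E <= integrability_sup tau f)%E.
Proof. by move=> s0 lf; apply: ereal_sup_ubound; exists s. Qed.

Lemma isup_le tau f g : (forall s, 0 < s -> Lp_loc s tau f -> Lp_loc s tau g) ->
  (integrability_sup tau f <= integrability_sup tau g)%E.
Proof.
move=> fg; apply: ge_ereal_sup => _ [s [s0 lf] <-].
exact: Lp_isup s0 (fg s s0 lf).
Qed.

Lemma isup_eq tau f g : (forall s, 0 < s -> Lp_loc s tau f <-> Lp_loc s tau g) ->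
  integrability_sup tau f = integrability_sup tau g.
Proof.
by move=> fg; apply/eqP; rewrite eq_le; apply/andP; split; apply: isup_le => s /fg[].
Qed.

Lemma isup_Lp s tau f : 0 < s -> (s%:E < integrability_sup tau f)%E ->
  Lp_loc s tau f.
Proof.
move=> s0 /ereal_sup_gt[_ [s' [s'0 lf] <-]]; rewrite lte_fin => ss.
exact: Lp_loc_mono (ltW ss) lf.
Qed.

Lemma isup_pinfty tau f : (forall s, 0 < s -> Lp_loc s tau f) ->
  integrability_sup tau f = +oo%E.
Proof.
move=> lf; case E : (integrability_sup tau f) => [x| |] //.
  have s0 : 0 < `|x| + 1 by rewrite ltr_pwDr.
  have := Lp_isup s0 (lf _ s0); rewrite E lee_fin leNgt => /negP; case.
  by rewrite (le_lt_trans (ler_norm x)) // ltrDl.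
by have := Lp_isup ltr01 (lf _ ltr01); rewrite E.
Qed.

(** The supremum need not be attained, so membership in L^s is known only for [s] strictly below it;
    [0 < m] provides such positive [s]. *)
Lemma le_pos_dense (m y : \bar R) : (0 < m)%E ->
  (forall s : R, 0 < s -> (s%:E < m)%E -> (s%:E <= y)%E) -> (m <= y)%E.
Proof.
case: m => [m| |] // m0 hs; last first.
  case: y hs => [y| |] // hs.
    have s0 : 0 < `|y| + 1 by rewrite ltr_pwDr.
    have := hs _ s0 (ltry _); rewrite lee_fin leNgt => /negP; case.
    by rewrite (le_lt_trans (ler_norm y)) // ltrDl.
  by have := hs _ ltr01 (ltry _).
rewrite lte_fin in m0.
case: y hs => [y| |] // hs.
- rewrite lee_fin leNgt; apply/negP => ym.
  (* A midpoint that is positive, below [m] and above [y]. *)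
  have := hs ((Num.max 0 y + m) / 2).
  have : 0 <= Num.max 0 y by rewrite le_max lexx.
  have : y <= Num.max 0 y by rewrite le_max lexx orbT.
  have : Num.max 0 y < m by rewrite gt_max m0.
  rewrite lte_fin lee_fin => h1 h2 h3 h4; have : 0 < (Num.max 0 y + m) / 2 by lra.
  move=> /h4; have -> : (Num.max 0 y + m) / 2 < m by lra.
  by move=> /(_ isT); lra.
- by rewrite leey.
- have := hs (m / 2); rewrite lte_fin => h1; have : 0 < m / 2 by lra.
  move=> /h1; have -> : m / 2 < m by lra.
  by move=> /(_ isT).
Qed.

Lemma min_le_pos_dense (a b y : \bar R) : (0 < a)%E -> (0 < b)%E ->
  (forall s : R, 0 < s -> (s%:E < a)%E -> (s%:E < b)%E -> (s%:E <= y)%E) ->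
  (Order.min a b <= y)%E.
Proof.
move=> a0 b0 h; apply: le_pos_dense; first by rewrite lt_min a0.
by move=> s s0; rewrite lt_min => /andP[]; exact: h.
Qed.

Lemma isup_min tau f g h :
  (forall s, 0 < s -> Lp_loc s tau f -> Lp_loc s tau g -> Lp_loc s tau h) ->
  (0 < integrability_sup tau f)%E -> (0 < integrability_sup tau g)%E ->
  (Order.min (integrability_sup tau f) (integrability_sup tau g)
     <= integrability_sup tau h)%E.
Proof.
move=> fgh f0 g0; apply: (min_le_pos_dense f0 g0) => s s0 sf sg.
exact: Lp_isup s0 (fgh s s0 (isup_Lp s0 sf) (isup_Lp s0 sg)).
Qed.

End LocalIntegrability.

(** * Negative powers of a polynomial *)

Section CircleSublevels.
Variable R : realType.
Local Notation C := R[i].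
Local Notation nc := (@ComplexField.Normc.normc R).
Local Notation mu := (@lebesgue_measure R).
Implicit Types (x y theta phi : R).

Lemma cos_pi4_ge : 2^-1 <= cos (pi / 4 : R).
Proof.
have h : 0 < cos (pi / 4 : R).
  apply: cos_gt0_pihalf; have := @pi_gt0 R; lra.
have : cos (pi / 4 *+ 2 : R) = cos (pi / 4) ^+ 2 *+ 2 - 1 by exact: cos_mulr2n.
have -> : pi / 4 *+ 2 = pi / 2 :> R by rewrite -mulr_natr; field.
rewrite cos_pihalf => /esym/eqP; rewrite subr_eq0 => /eqP h2.
rewrite -(@ler_pXn2r _ 2) ?nnegrE ?invr_ge0 ?(ltW h) //.
by move: h2; rewrite -mulr_natr; lra.
Qed.

(** A weak Jordan inequality: the mean value theorem with [cos >= 1/2] up to [pi / 4], and beyond it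
    [sin x >= 1/2 >= x / 4] because [pi / 2 < 2]. *)
Lemma sin_ge_quarter x : 0 <= x <= pi / 2 -> x / 4 <= sin x.
Proof.
have p0 := @pi_gt0 R; have p2 := @pihalf_lt2 R; have c4 := cos_pi4_ge.
have small y : 0 <= y <= pi / 4 -> y / 2 <= sin y.
  move=> /andP[y0 y1].
  have [|c] := @MVT_segment R sin cos 0 y y0 (fun z _ => is_derive_sin z).
    by apply: continuous_subspaceT; exact: continuous_sin.
  rewrite in_itv /= => /andP[c0 c1]; rewrite sin0 !subr0 => ->.
  have cc : 2^-1 <= cos c.
    apply: le_trans c4 _; rewrite leNgt ltr_cos -?leNgt ?in_itv /= ?c0 /=; lra.
  by rewrite [leLHS]mulrC ler_wpM2r.
move=> /andP[x0 x1]; have [x4|x4] := leP x (pi / 4).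
  by have := small x; rewrite x0 x4 => /(_ isT); lra.
have h4 : sin (pi / 4) < sin x.
  by rewrite ltr_sin // in_itv /=; apply/andP; split; lra.
have s4 : sin (pi / 4 : R) = cos (pi / 4).
  by rewrite -cosBpihalf -cosN; congr cos; field.
lra.
Qed.

Lemma nc_chord theta phi :
  nc ((cos theta +i* sin theta) - (cos phi +i* sin phi)) =
  2 * `|sin ((theta - phi) / 2)|.
Proof.
rewrite nc_def /=.
have -> : (cos theta - cos phi) ^+ 2 + (sin theta - sin phi) ^+ 2 =
    (2 * sin ((theta - phi) / 2)) ^+ 2.
  have := cosB theta phi; have := cos2Dsin2 theta; have := cos2Dsin2 phi.
  have {1}-> : theta - phi = (theta - phi) / 2 *+ 2 by rewrite -mulr_natr; field.
  rewrite cos_mulr2n; have := cos2Dsin2 ((theta - phi) / 2).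
  rewrite -mulr_natr; nra.
by rewrite sqrtr_sqr normrM gtr0_norm.
Qed.

(* Angles in ]-pi, pi] of two close points may differ by almost 2 pi. *)
Lemma chord_dist theta phi (d : R) :
  theta \in `]- pi, pi] -> phi \in `]- pi, pi] ->
  nc ((cos theta +i* sin theta) - (cos phi +i* sin phi)) < d ->
  [\/ `|phi - theta| < 4 * d, `|phi + pi *+ 2 - theta| < 4 * d |
      `|phi - pi *+ 2 - theta| < 4 * d].
Proof.
have p0 := @pi_gt0 R.
(* A small sine places the half-angle [x] near 0 or near [pi]; the second case is the wrap-around of
   the angles. *)
have key x : 0 <= x < pi -> `|sin x| < d / 2 -> x < 2 * d \/ pi - x < 2 * d.
  move=> /andP[x0 x1]; rewrite ger0_norm; last by apply: sin_ge0_pi; rewrite x0 ltW.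
  have [x2|x2] := leP x (pi / 2).
    by have := @sin_ge_quarter x; rewrite x0 x2 => /(_ isT); left; lra.
  have := @sin_ge_quarter (pi - x).
  have -> : sin (pi - x) = sin x by rewrite sinB sinpi cospi; ring.
  have -> : 0 <= pi - x <= pi / 2 by apply/andP; split; lra.
  by move=> /(_ isT); right; lra.
rewrite nc_chord !in_itv /= => /andP[t1 t2] /andP[f1 f2] h.
have h' : `|sin ((theta - phi) / 2)| < d / 2 by lra.
rewrite !mulr2n; have [tf|tf] := leP phi theta.
  have /key : 0 <= (theta - phi) / 2 < pi by apply/andP; split; lra.
  case/(_ h') => hd; [apply: Or31|apply: Or32]; rewrite ltr_norml;
    apply/andP; split; lra.
have /key : 0 <= (phi - theta) / 2 < pi by apply/andP; split; lra.
have -> : (phi - theta) / 2 = - ((theta - phi) / 2) by lra.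
rewrite sinN normrN => /(_ h')[] hd; [apply: Or31|apply: Or33]; rewrite ltr_norml;
    apply/andP; split; lra.
Qed.

Definition near_angles (c : C) (eta : R) : set R :=
  [set theta | theta \in `]- pi, pi] /\
     nc ((cos theta +i* sin theta) - c) < eta].

(** Two members are at chord distance below [2 eta], so all lie within [8 eta] of one fixed member
    [phi] or of its translates by [2 pi] in either direction. Three intervals of length [16 eta]
    give the constant 48. *)
Lemma near_angles_cover (c : C) (eta : R) : 0 < eta ->
  exists U : set R, [/\ measurable U, (mu U <= (48 * eta)%:E)%E &
    near_angles c eta `<=` U].
Proof.
move=> eta0; have [[phi [phi1 phi2]]|n0] := pselect (exists x, near_angles c eta x); last first.
  exists set0; split; first exact: measurable0.
    by rewrite measure0 lee_fin mulr_ge0 // ltW.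
  by move=> x cx; apply: n0; exists x.
pose a := phi + pi *+ 2; pose b := phi - pi *+ 2.
have e8 : 0 <= 8 * eta by rewrite mulr_ge0 // ltW.
exists (ball phi (8 * eta) `|` ball (a) (8 * eta) `|`
        ball (b) (8 * eta)); split.
- by apply: measurableU; [apply: measurableU|]; exact: measurable_ball.
- apply: (@le_trans _ _ (mu (ball phi (8 * eta)) +
     mu (ball (a) (8 * eta)) + mu (ball (b) (8 * eta)))%E).
    apply: le_trans (measureU2 _ _ _) _; rewrite ?leeD2r ?measureU2 //;
      do ?apply: measurableU; exact: measurable_ball.
  rewrite !lebesgue_measure_ball // -!EFinD lee_fin !mulr2n; lra.
- move=> theta [t1 t2].
  have : nc ((cos theta +i* sin theta) - (cos phi +i* sin phi)) < 2 * eta.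
    apply: le_lt_trans (_ : nc ((cos theta +i* sin theta) - c) +
        nc (c - (cos phi +i* sin phi)) < _).
      by apply: le_trans (ncD _ _); rewrite subrKA.
    by rewrite [nc (c - _)]ncB; lra.
  have -> : 8 * eta = 4 * (2 * eta) by lra.
  by case/(chord_dist t1 phi1) => h; [left; left|left; right|right].
Qed.

(** A product of [size s] factors that is below [eta ^+ size s] has a factor below [eta]; the covers
    for the single roots add up. *)
Lemma near_roots_cover (s : seq C) (eta : R) : 0 < eta ->
  exists U : set R, [/\ measurable U, (mu U <= (48 * eta * (size s)%:R)%:E)%E &
    forall theta, theta \in `]- pi, pi] ->
      nc (\prod_(c <- s) ((cos theta +i* sin theta) - c)) < eta ^+ size s ->
      U theta].
Proof.
move=> eta0; elim: s => [|c s [U [mU muU hU]]].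
  exists set0; split; first exact: measurable0.
    by rewrite measure0 mulr0.
  by move=> theta _; rewrite big_nil nc1 expr0 ltxx.
have [V [mV muV hV]] := near_angles_cover c eta0.
exists (V `|` U); split; first exact: measurableU.
  apply: le_trans (measureU2 _ _ _) _ => //.
  by apply: le_trans (leeD muV muU) _; rewrite -EFinD lee_fin /= -natr1; lra.
move=> theta t1; rewrite big_cons ncM /= exprS => h.
have [ct|ct] := ltP (nc ((cos theta +i* sin theta) - c)) eta.
  by left; apply: hV.
right; apply: hU => //; rewrite ltNge; apply/negP => h2.
move: h; rewrite ltNge => /negP; apply.
by apply: ler_pM => //; [exact: ltW|exact/exprn_ge0/ltW].
Qed.

End CircleSublevels.

(** * Measure of the sublevel sets of a polynomial on the torus *)

Section TorusSublevels.
Variable R : realType.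
Local Notation C := R[i].
Local Notation nc := (@ComplexField.Normc.normc R).
Local Notation T2 := (measurableTypeR R * measurableTypeR R)%type.
Local Notation mu := (@lebesgue_measure R).
Local Notation mu2 := (@lebesgue_measure R \x @lebesgue_measure R)%E.
Implicit Types (p : {poly {poly C}}).

Definition torus_square : set T2 := `]- pi, pi] `*` `]- pi, pi].

Lemma measurable_torus_square : measurable torus_square.
Proof. by apply: measurableX; exact: measurable_itv. Qed.

Lemma mu_angles : mu `]- pi, pi]%classic = (2 * pi)%:E.
Proof.
rewrite lebesgue_measure_itv /= lte_fin.
have p0 := @pi_gt0 R; have -> : - pi < pi :> R by lra.
by rewrite -EFinB; congr EFin; ring.
Qed.

Lemma mu2_torus_square : mu2 torus_square = ((2 * pi) * (2 * pi))%:E.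
Proof. by rewrite product_measure1E //= mu_angles -EFinM. Qed.

Definition torus_sublevel p (e : R) : set T2 :=
  torus_square `&` [set t | nc (ev p (torus_pt t)) < e].

Lemma measurable_torus_sublevel p e : measurable (torus_sublevel p e).
Proof.
have m : measurable_fun torus_square (fun t => nc (ev p (torus_pt t))).
  by apply: cmeas_nc; exact: cmeas_ev.
have -> : torus_sublevel p e =
   torus_square `&` (fun t => nc (ev p (torus_pt t))) @^-1` `]-oo, e[.
  by apply/seteqP; split => t [t1]; rewrite /= in_itv.
by apply: m => //; exact: measurable_torus_square.
Qed.

Lemma horner_prod_roots (q : {poly C}) : q != 0 -> exists s : seq C,
  size s = (size q).-1 /\
  forall x, q.[x] = lead_coef q * \prod_(c <- s) (x - c).
Proof.
move=> q0; have [s sP] := closed_field_poly_normal q; exists s.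
split; first by rewrite [in RHS]sP size_scale ?lead_coef_eq0 // size_prod_XsubC.
move=> x; rewrite {1}sP hornerZ horner_prod; congr (_ * _).
by apply: eq_bigr => c _; rewrite hornerXsubC.
Qed.

Lemma product_measure_section_le (E : set T2) (J : set R) (k : R) : 0 <= k ->
  measurable E -> measurable (J : set (measurableTypeR R)) ->
  (forall x, J x -> (mu (xsection E x) <= k%:E)%E) ->
  (forall x, ~ J x -> xsection E x = set0) ->
  (mu2 E <= k%:E * mu J)%E.
Proof.
move=> k0 mE mJ Jk nJ.
have -> : mu J = (\int[mu]_x (\1_J x)%:E)%E.
  by rewrite (integral_indic mu measurableT mJ) setIT.
rewrite -ge0_integralZl_EFin //; last first.
  by apply/measurable_EFinP; exact: measurable_indic.
apply: ge0_le_integral => //.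
- exact: measurable_fun_xsection.
- apply: measurable_funeM; apply/measurable_EFinP; exact: measurable_indic.
move=> x _ /=; have [xJ|xJ] := pselect (J x).
  by rewrite indicE mem_set // mule1; exact: Jk.
rewrite nJ // measure0; apply: mule_ge0; rewrite ?lee_fin //.
Qed.

Lemma ev_swapXY p (z : C * C) :
  ev p z = (map_poly (horner_eval z.1) (swapXY p)).[z.2].
Proof. by rewrite /ev horner_polyC. Qed.

(* As a polynomial in z_2, p is c(z_1) times a product of d linear factors, and
   c(z_1) is c_0 times a product of e linear factors; if |p| < c_0 eta^(e + d), one
   of these e + d factors is smaller than eta. *)
Lemma torus_sublevel_small p : p != 0 -> exists c0 : R, 0 < c0 /\
  exists D : nat, exists K : R, 0 <= K /\
  forall eta : R, 0 < eta ->
    (mu2 (torus_sublevel p (c0 * eta ^+ D)) <= (K * eta)%:E)%E.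
Proof.
move=> p0; pose q := swapXY p.
have q0 : q != 0 by rewrite swapXY_eq0.
have c_neq0 : lead_coef q != 0 by rewrite lead_coef_eq0.
have [s [sz sP]] := horner_prod_roots c_neq0.
pose e := size s; pose d := (size q).-1.
exists (nc (lead_coef (lead_coef q))); split.
  by rewrite nc_gt0 lead_coef_eq0.
(* The 48 of [near_roots_cover] times the length [2 pi] of the other side of the square. *)
exists (e + d)%N; pose k := 48 * (2 * pi) : R.
have p_0 := @pi_gt0 R.
exists (k * e%:R + k * d%:R); split.
  by rewrite addr_ge0 ?mulr_ge0 // ltW.
move=> eta eta0.
have [U [mU muU hU]] := near_roots_cover s eta0.
set E := torus_sublevel _ _.
have mE : measurable E := measurable_torus_sublevel _ _.
pose J : set (measurableTypeR R) := `]- pi, pi]%classic.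
have mJ : measurable J by exact: measurable_itv.
have muJ : mu J = (2 * pi)%:E := mu_angles.
have mUJ : measurable (U `*` J : set T2) by exact: measurableX.
have mE' : measurable (E `\` (U `*` J)) by exact: measurableD.
(* The strip over [U] covers the z_1 at which the leading coefficient is small and costs the [e]
   term; off it, the sections in z_2 cost the [d] term. *)
apply: (@le_trans _ _ (mu2 (U `*` J : set T2) + mu2 (E `\` (U `*` J)))%E).
  apply: le_trans (measureU2 _ _ _); rewrite //.
  apply: le_measure; rewrite ?inE //; first exact: measurableU.
  by move=> t Et; have [tu|tu] := pselect ((U `*` J) t); [left|right].
rewrite mulrDl EFinD; apply: leeD.
  rewrite [X in (X <= _)%E](_ : _ = (mu U * mu J)%E); last exact: product_measure1E.
  rewrite muJ.
  apply: le_trans (lee_wpmul2r _ muU) _; first by rewrite lee_fin mulr_ge0 // ltW.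
  by rewrite -EFinM lee_fin /k -/e; rewrite le_eqVlt (_ : _ == _) //; apply/eqP; ring.
apply: le_trans (_ : ((48 * eta * d%:R)%:E * mu J <= _)%E); last first.
  by rewrite muJ -EFinM lee_fin /k; rewrite le_eqVlt (_ : _ == _) //; apply/eqP; ring.
apply: product_measure_section_le => //.
- by rewrite !mulr_ge0 // ltW.
- move=> x Jx; have [xU|xU] := pselect (U x).
    rewrite (_ : xsection _ _ = set0) ?measure0 ?lee_fin ?mulr_ge0 ?(ltW eta0) //.
    apply/seteqP; split => // y /xsectionP[[[_ yJ] _]] [] //.
  pose z1 : C := cos x +i* sin x.
  have cz : nc (lead_coef (lead_coef q)) * eta ^+ e <= nc (lead_coef q).[z1].
    rewrite sP ncM ler_wpM2l ?nc_ge0 // leNgt; apply/negP => h.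
    by apply: xU; apply: hU => //; exact: h.
  have cz0 : (lead_coef q).[z1] != 0.
    rewrite -nc_gt0; apply: lt_le_trans cz.
    by rewrite mulr_gt0 ?exprn_gt0 // nc_gt0 lead_coef_eq0.
  (* Since [lead_coef q] does not vanish at [z1], [qx] keeps the degree [d], and [cz] bounds its
     leading coefficient from below. *)
  pose qx := map_poly (horner_eval z1) q.
  have lqx : lead_coef qx = (lead_coef q).[z1].
    by rewrite lead_coef_map_eq //.
  have qx0 : qx != 0 by rewrite -lead_coef_eq0 lqx.
  have [r [szr rP]] := horner_prod_roots qx0.
  have szq : size r = d.
    by rewrite szr /d size_poly_eq // ?lead_coefE.
  have [V [mV muV hV]] := near_roots_cover r eta0.
  rewrite szq in muV.
  apply: le_trans muV; apply: le_measure; rewrite ?inE //.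
    exact: measurable_xsection.
  move=> y /xsectionP[[[_ yJ] hE] _]; apply: hV => //; rewrite szq.
  rewrite ltNge; apply/negP => h; move: hE => /=.
  rewrite ltNge => /negP; apply.
  rewrite ev_swapXY /= -/z1 -/q -/qx rP lqx ncM exprD mulrA.
  by apply: ler_pM => //; rewrite ?mulr_ge0 ?exprn_ge0 ?nc_ge0 ?ltW.
- move=> x nJ; apply/seteqP; split => // y /xsectionP[[[]]] //.
Qed.

End TorusSublevels.

(** * Integrability of a small negative power *)

Section NegativePowers.
Variable R : realType.
Local Notation C := R[i].
Local Notation nc := (@ComplexField.Normc.normc R).
Local Notation T2 := (measurableTypeR R * measurableTypeR R)%type.
Local Notation mu2 := (@lebesgue_measure R \x @lebesgue_measure R)%E.
Implicit Types (p : {poly {poly C}}).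

Lemma le_nneseries_term (u : nat -> \bar R) m : (forall n, 0 <= u n)%E ->
  (u m <= \sum_(0 <= i <oo) u i)%E.
Proof.
move=> u0; apply: le_trans (@nneseries_lim_ge _ u xpredT 0 m.+1 _); last first.
  by move=> n _ _; exact: u0.
by rewrite big_nat_recr //= leeDr // sume_ge0.
Qed.

Lemma dyadic_nneseries (c : R) : 0 <= c ->
  (\sum_(0 <= m <oo) (c / (2 ^ m)%:R)%:E < +oo)%E.
Proof.
move=> c0; apply: le_lt_trans (ltry (c * 2)).
apply: le_trans (@epsilon_trick0 R (c * 2) xpredT _); last by rewrite mulr_ge0.
rewrite le_eqVlt; apply/orP; left; apply/eqP; apply: eq_eseriesr => m _.
by congr EFin; rewrite expnS natrM invfM mulrA mulfK.
Qed.

(* Layers |p| ~ c_0 4^(-m D) with s = 1/(2 D): there |p|^(-s) is about 2^m, on a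
   set of measure O(4^(-m)). *)
Lemma Lp_loc_inv_small p tau : p != 0 ->
  exists2 s : R, 0 < s & Lp_loc s tau (fun z => (ev p z)^-1).
Proof.
move=> /torus_sublevel_small[c0 [c00 [D [K [K0 small]]]]].
(* [D.+1] keeps the exponent defined when [D = 0]; the sublevel sets only shrink, since
   [4^(-m) <= 1]. *)
pose s : R := (2 * D.+1)%:R^-1.
have s0 : 0 < s by rewrite invr_gt0 ltr0n.
have cs0 : 0 <= c0^-1 `^ s by exact: powR_ge0.
have q4 (m : nat) : 0 < (4 ^ m)%:R^-1 :> R by rewrite invr_gt0 ltr0n expn_gt0.
have q41 (m : nat) : (4 ^ m)%:R^-1 <= 1 :> R.
  by rewrite invf_le1 ?ltr0n ?ler1n expn_gt0.
(* The level is shifted by one: if [m] is least with [c0 4^(-m (D+1)) <= |p|] at [t], the inequality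
   fails at [m - 1], which puts [t] in [A m]; for [m = 0] nothing is known beyond the square. *)
pose A (m : nat) := if m is n.+1 then
  torus_sublevel p (c0 * (4 ^ n)%:R^-1 ^+ D.+1) else @torus_square R.
have mA m : measurable (A m).
  case: m => [|m]; first exact: measurable_torus_square.
  exact: measurable_torus_sublevel.
(* The area of the square bounds [A 0]; the factor 4 pays for the shift of the level. *)
pose K' := 2 * pi * (2 * pi) + 4 * K : R.
have K'0 : 0 <= K' by rewrite addr_ge0 ?mulr_ge0 // ?pi_ge0.
have muA m : (mu2 (A m) <= (K' / (4 ^ m)%:R)%:E)%E.
  case: m => [|m].
    by rewrite [A _]/= mu2_torus_square lee_fin expn0 divr1 lerDl mulr_ge0.
  apply: le_trans (_ : mu2 (torus_sublevel p (c0 * (4 ^ m)%:R^-1 ^+ D)) <= _)%E.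
    apply: le_measure; rewrite ?inE //; first exact: measurable_torus_sublevel.
    move=> t [t1 /= t2]; split => //=; apply: lt_le_trans t2 _.
    by rewrite ler_wpM2l ?(ltW c00) // exprSr ler_piMr ?exprn_ge0 // ltW.
  apply: le_trans (small _ (q4 m)) _; rewrite lee_fin expnS natrM invfM mulrA.
  rewrite ler_wpM2r ?(ltW (q4 m)) // ler_pdivlMr ?ltr0n //.
  by rewrite mulrC lerDr !mulr_ge0 // pi_ge0.
pose g (m : nat) (t : T2) : \bar R :=
  ((c0^-1 `^ s * (2 ^ m)%:R)%:E * (\1_(A m) t)%:E)%E.
have g0 m t : (0 <= g m t)%E.
  by rewrite mule_ge0 // lee_fin // mulr_ge0.
have mg m : measurable_fun (@torus_square R) (g m).
  by apply: measurable_funeM; apply/measurable_EFinP; exact: measurable_indic.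
pose f (t : T2) := (nc (ev p (torus_pt t))^-1 `^ s)%:E.
have mf : measurable_fun (@torus_square R) f.
  by apply: measurable_nc_powR; apply: cmeasV; exact: cmeas_ev.
have fg t : @torus_square R t -> (f t <= \sum_(0 <= m <oo) g m t)%E.
  move=> tJ; rewrite /f ncV; set x := nc _.
  (* At a zero of [p] the inverse is 0 by convention, and so is its power. *)
  have [x0|x0] := eqVneq x 0.
    by rewrite x0 invr0 powR0 ?gt_eqF // nneseries_ge0.
  have xp : 0 < x by rewrite lt0r x0 nc_ge0.
  have ex : exists m, c0 * (4 ^ m)%:R^-1 ^+ D.+1 <= x.
    exists (Num.bound (c0 / x)); set m := Num.bound _.
    apply: le_trans (_ : c0 * (4 ^ m)%:R^-1 <= _).
      by rewrite ler_wpM2l ?(ltW c00) // exprS ler_piMr ?(ltW (q4 m)) //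
         exprn_ile1 // ltW.
    rewrite ler_pdivrMr ?ltr0n ?expn_gt0 // mulrC -ler_pdivrMr //.
    apply: le_trans (ltW (archi_boundP _)) _; first by rewrite divr_ge0 // ltW.
    by rewrite ler_nat ltnW // ltn_expl.
  case: (ex_minnP ex) => m xm minm.
  apply: le_trans (le_nneseries_term m (fun n => g0 n t)).
  have tA : A m t.
    case: m {xm} minm => [|m] minm //; split => //=.
    by rewrite ltNge; apply/negP => /minm; rewrite ltnn.
  rewrite /g indicE mem_set // mule1 lee_fin.
  have -> : (2 ^ m)%:R = (((4 ^ m)%:R ^+ D.+1) `^ s) :> R.
    have -> : (4 ^ m)%:R ^+ D.+1 = (2 ^ m)%:R `^ (2 * D.+1)%:R :> R.
      rewrite powR_mulrn // exprM; congr (_ ^+ _).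
      by rewrite -natrX; congr (_%:R);  rewrite -expnM mulnC expnM.
    by rewrite -powRrM mulfV ?powRr1 // pnatr_eq0.
  rewrite -powRM ?invr_ge0 ?(ltW c00) ?exprn_ge0 //.
  apply: ge0_ler_powR; rewrite ?nnegrE ?invr_ge0 ?(ltW xp) ?(ltW s0) //.
    by rewrite mulr_ge0 ?invr_ge0 ?(ltW c00) ?exprn_ge0.
  have y0 : 0 < c0 * (4 ^ m)%:R^-1 ^+ D.+1 by rewrite mulr_gt0 ?exprn_gt0.
  rewrite -[leRHS]invrK lef_pV2 ?posrE ?invr_gt0 ?mulr_gt0 ?invr_gt0 ?exprn_gt0
    ?ltr0n ?expn_gt0 //.
  by rewrite invfM invrK -exprVn.
exists s => //; apply/Lp_loc_tbox; exists 1 => //; split.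
  by apply: cmeasV; exact: cmeas_ev.
apply: (@le_lt_trans _ _ (\int[mu2]_(t in @torus_square R) f t)%E).
  apply: ge0_subset_integral => //; first exact: measurable_tbox.
  - exact: measurable_torus_square.
  - by move=> t _; rewrite lee_fin powR_ge0.
  - exact: subIsetl.
apply: (@le_lt_trans _ _
    (\int[mu2]_(t in @torus_square R) (\sum_(0 <= m <oo) g m t))%E).
  apply: ge0_le_integral => //; first exact: measurable_torus_square.
  - by move=> t _; rewrite lee_fin powR_ge0.
  - by apply: ge0_emeasurable_sum.
rewrite integral_nneseries //; last exact: measurable_torus_square.
apply: le_lt_trans (dyadic_nneseries (mulr_ge0 cs0 K'0)).
apply: lee_nneseries => [m _ _|m _].
  by apply: integral_ge0 => t _.
rewrite ge0_integralZl_EFin //; last 3 first.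
- exact: measurable_torus_square.
- by apply/measurable_EFinP; exact: measurable_indic.
- by rewrite mulr_ge0.
rewrite integral_indic //; last exact: measurable_torus_square.
apply: le_trans (lee_wpmul2l _ (le_trans _ (muA m))) _.
- by rewrite lee_fin mulr_ge0.
- apply: le_measure; rewrite ?inE //.
  by apply: measurableI => //; exact: measurable_torus_square.
rewrite -EFinM lee_fin (_ : (4 ^ m)%:R = (2 ^ m)%:R * (2 ^ m)%:R :> R); last first.
  by rewrite -natrM -expnMn.
rewrite invfM le_eqVlt; apply/orP; left; apply/eqP.
have : (2 ^ m)%:R != 0 :> R by rewrite pnatr_eq0 -lt0n expn_gt0.
by move=> ?; field.
Qed.

End NegativePowers.

(** * The derivative of q/p *)

Section Germs.
Variable R : realType.
Local Notation C := R[i].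
Local Notation nc := (@ComplexField.Normc.normc R).
Local Notation T2 := (measurableTypeR R * measurableTypeR R)%type.
Implicit Types (a b q u v : dseries R) (p : {poly {poly C}}) (z tau : C * C).

Lemma cmeas_near_ds_eval tau a : convergent a -> cmeas_near tau (ds_eval tau a).
Proof.
move=> /convergentP[r r0 [M aM]]; exists r => //.
apply: (@cmeas_cvg _ _ (fun n t => dsum (dterm a ((torus_pt t).1 - tau.1,
   (torus_pt t).2 - tau.2)) n)); last first.
  by move=> t [_ tr]; case: (ds_eval_cvg aM tr).
move=> n; apply: cmeas_sum => j; apply: cmeas_sum => k.
apply: cmeasM; [apply: cmeasM|]; first exact: cmeas_cst.
  by apply: cmeasX; apply: cmeasD; [exact: cmeas_torus1|exact: cmeas_cst].
by apply: cmeasX; apply: cmeasD; [exact: cmeas_torus2|exact: cmeas_cst].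
Qed.

Lemma cmeas_near_ds_deriv tau a : convergent a -> cmeas_near tau (ds_deriv tau a).
Proof.
move=> /convergentP[r r0 [M aM]]; exists (r / 4); first by rewrite divr_gt0.
apply: (@cmeas_cvg _ _ (fun n t => dsum (deriv_term a ((torus_pt t).1 - tau.1,
   (torus_pt t).2 - tau.2)) n)); last first.
  by move=> t [_ tr]; case: (ds_deriv_cvg r0 aM tr).
move=> n; apply: cmeas_sum => j; apply: cmeas_sum => k.
apply: cmeasM; [apply: cmeasM|]; first exact: cmeas_cst.
  apply: cmeasM; first exact: cmeas_cst.
  by apply: cmeasX; apply: cmeasD; [exact: cmeas_torus1|exact: cmeas_cst].
by apply: cmeasX; apply: cmeasD; [exact: cmeas_torus2|exact: cmeas_cst].
Qed.

Lemma ds_eval_bounded tau a : convergent a ->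
  exists M : R, near_torus tau (fun z => nc (ds_eval tau a z) <= M).
Proof.
move=> /ds_eval_near-/(_ tau)[M h]; exists M; apply: near_near_torus.
by apply: filterS h => z [].
Qed.

Lemma ds_deriv_near tau a : convergent a -> exists M : R,
  \forall z \near (tau : C^o * C^o), nc (ds_deriv tau a z) <= M /\
  is_derive (z.1 : C^o) (1 : C^o) (fun w : C^o => ds_eval tau a (w, z.2) : C^o)
    (ds_deriv tau a z).
Proof.
move=> /convergentP[r r0 [M aM]]; exists (M / (r / 4)).
have r40 : 0 < r / 4 by rewrite divr_gt0.
apply: filterS (near_box tau r40) => z zr; split.
  by case: (ds_deriv_cvg r0 aM zr).
exact: is_derive_ds_eval zr.
Qed.

Lemma cmeas_near_germ_quotient tau a p : convergent a ->
  cmeas_near tau (germ_quotient tau a p).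
Proof.
move=> ca; apply: cmeas_nearM; first exact: cmeas_near_ds_eval.
by apply: cmeas_nearV; exact: cmeas_near_ev.
Qed.

(** The numerator is bounded near [tau], so the power [s / 2] of the quotient is at most a constant
    times [|p|^(-s)]. *)
Lemma isup_germ_quotient_gt0 tau a p : p != 0 -> convergent a ->
  (0 < integrability_sup tau (germ_quotient tau a (p ^+ 2)))%E.
Proof.
move=> p0 ca; have [s s0 ls] := Lp_loc_inv_small tau p0.
have s20 : 0 < s / 2 by rewrite divr_gt0.
have [M aM] := ds_eval_bounded tau ca.
suff lq : Lp_loc (s / 2) tau (germ_quotient tau a (p ^+ 2)).
  by apply: lt_le_trans (Lp_isup s20 lq); rewrite lte_fin.
apply: (@Lp_loc_dominated _ (s / 2) s s (`|M| `^ (s / 2)) _ _ _ _ _ _ ls ls).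
- exact: powR_ge0.
- exact: cmeas_near_germ_quotient.
apply: near_torus_sub aM => z zM; rewrite /germ_quotient evX ncM ncV ncX.
rewrite powRM ?nc_ge0 ?invr_ge0 ?exprn_ge0 ?nc_ge0 //.
apply: ler_pM; rewrite ?powR_ge0 //.
  by apply: ge0_ler_powR; rewrite ?nnegrE ?nc_ge0 ?(ltW s20) // (le_trans zM) ?ler_norm.
have -> : (nc (ev p z) ^+ 2)^-1 `^ (s / 2) = nc (ev p z)^-1 `^ s.
  rewrite -exprVn -ncV -powR_mulrn ?nc_ge0 // -powRrM.
  by congr (_ `^ _); rewrite mulrC divfK.
by rewrite lerDl powR_ge0.
Qed.

(** On the torus [1 / conj z = z], so [ev_reflection] gives the conjugate of [p] at [z] times a
    monomial of modulus 1. *)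
Lemma nc_reflection p z : nc z.1 = 1 -> nc z.2 = 1 ->
  nc (ev (reflection p) z) = nc (ev p z).
Proof.
move=> z1 z2.
have conj_inv (x : C) : nc x = 1 -> (conjc x)^-1 = x.
  move=> x1; have x0 : x != 0 by rewrite -nc_gt0 x1.
  have cx0 : conjc x != 0 by rewrite -nc_gt0 nc_conj x1.
  apply: (mulfI cx0); rewrite divff // mulrC -sqr_normc normC_nc x1.
  by rewrite expr1n.
rewrite ev_reflection -?nc_gt0 ?z1 ?z2 // !conj_inv //.
by rewrite !ncM !ncX z1 z2 !expr1n !mul1r nc_conj; case: (z).
Qed.

Variables (p : {poly {poly C}}) (tau : C * C).
Hypothesis p_neq0 : p != 0.
Hypothesis p_isolated : near_torus tau (fun z => z <> tau -> ev p z != 0).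
Local Notation pt := (reflection p).

(* The numerator of d/dz_1 (pt / p); the outer variable is z_1, so [^`()] is
   d/dz_1. *)
Definition wronskian : {poly {poly C}} := pt^`() * p - pt * p^`().

(** Written as a germ over [p ^+ 2], the shape that [integrability_index] requires of its
    witness. *)
Definition wronskian_quotient v : C * C -> C :=
  germ_quotient tau (ds_mul v (taylor tau wronskian)) (p ^+ 2).

Definition wronskian_index v := integrability_sup tau (wronskian_quotient v).

Lemma wronskian_quotientE v : convergent v ->
  \forall z \near (tau : C^o * C^o),
  wronskian_quotient v z = ds_eval tau v z * ev wronskian z / ev p z ^+ 2.
Proof.
move=> cv; apply: filterS (ds_evalM tau cv (taylor_convergent tau wronskian)) => z.
by rewrite /wronskian_quotient /germ_quotient evX ds_eval_taylor => ->.
Qed.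

Lemma convergent_wronskian v : convergent v ->
  convergent (ds_mul v (taylor tau wronskian)).
Proof. by move=> cv; apply: convergentM => //; exact: taylor_convergent. Qed.

Lemma wronskian_index_gt0 v : convergent v -> (0 < wronskian_index v)%E.
Proof.
move=> cv; apply: isup_germ_quotient_gt0 => //; exact: convergent_wronskian.
Qed.

Lemma wronskian_quotientD v w : convergent v -> convergent w ->
  near_torus tau (fun z => z <> tau ->
   wronskian_quotient v z + wronskian_quotient w z =
   wronskian_quotient (fun j k => v j k + w j k) z).
Proof.
move=> cv cw.
have := wronskian_quotientE cv; have := wronskian_quotientE cw.
have := wronskian_quotientE (convergentD cv cw).
have := ds_evalD tau cv cw => h1 h2 h3 h4; apply: near_near_torus.
near=> z => _.
have -> : wronskian_quotient v z = ds_eval tau v z * ev wronskian z / ev p z ^+ 2.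
  by near: z.
have -> : wronskian_quotient w z = ds_eval tau w z * ev wronskian z / ev p z ^+ 2.
  by near: z.
rewrite -!mulrDl.
have <- : ds_eval tau (fun j k => v j k + w j k) z =
    ds_eval tau v z + ds_eval tau w z by near: z.
by apply/esym; near: z.
Unshelve. all: by end_near. Qed.

Lemma wronskian_quotientZ (c : C) v : convergent v ->
  near_torus tau (fun z => z <> tau ->
   c * wronskian_quotient v z = wronskian_quotient (fun j k => c * v j k) z).
Proof.
move=> cv; have := wronskian_quotientE cv.
have := wronskian_quotientE (convergentZ c cv).
have := ds_evalZ c tau cv => h1 h2 h3; apply: near_near_torus.
near=> z => _.
have -> : wronskian_quotient v z = ds_eval tau v z * ev wronskian z / ev p z ^+ 2.
  by near: z.
rewrite !mulrA.
have <- : ds_eval tau (fun j k => c * v j k) z = c * ds_eval tau v z by near: z.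
by apply/esym; near: z.
Unshelve. all: by end_near. Qed.

Lemma wronskian_indexD v w : convergent v -> convergent w ->
  (Order.min (wronskian_index v) (wronskian_index w) <=
   wronskian_index (fun j k => (v j k + w j k)%R))%E.
Proof.
move=> cv cw; apply: isup_min; try exact: wronskian_index_gt0.
move=> s s0 lv lw.
exact: Lp_loc_eq (wronskian_quotientD cv cw) (Lp_locD s0 lv lw).
Qed.

Lemma wronskian_indexZ (c : C) v : convergent v ->
  (wronskian_index v <= wronskian_index (fun j k => (c * v j k)%R))%E.
Proof.
move=> cv; apply: isup_le => s s0 lv.
exact: Lp_loc_eq (wronskian_quotientZ c cv) (Lp_locZ c s0 lv).
Qed.

Definition ideal_combination u v : dseries R :=
  fun j k => ds_mul u (taylor tau p) j k + ds_mul v (taylor tau pt) j k.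

Lemma ds_eval_combination u v : convergent u -> convergent v ->
  \forall z \near (tau : C^o * C^o),
  ds_eval tau (ideal_combination u v) z =
  ds_eval tau u z * ev p z + ds_eval tau v z * ev pt z.
Proof.
move=> cu cv.
have h1 := ds_evalM tau cu (taylor_convergent tau p).
have h2 := ds_evalM tau cv (taylor_convergent tau pt).
have h3 := ds_evalD tau (convergentM cu (taylor_convergent tau p))
                    (convergentM cv (taylor_convergent tau pt)).
apply: filterS3 h1 h2 h3 => z h1 h2 h3.
rewrite -(ds_eval_taylor tau p z) -(ds_eval_taylor tau pt z) -h1 -h2.
exact: h3.
Qed.

(** An inequality, because the quotient is 0 by convention where [p] vanishes. *)
Lemma unimodular_quotient z : nc z.1 = 1 -> nc z.2 = 1 ->
  nc (ev pt z / ev p z) <= 1.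
Proof.
move=> z1 z2; rewrite ncM ncV nc_reflection //.
by have [->|h] := eqVneq (nc (ev p z)) 0; rewrite ?mul0r // divff.
Qed.

Lemma ev_bounded (P : {poly {poly C}}) :
  exists M : R, near_torus tau (fun z => nc (ev P z) <= M).
Proof.
have [M h] := ds_eval_bounded tau (taylor_convergent tau P); exists M.
by apply: near_torus_sub h => z; rewrite ds_eval_taylor.
Qed.

(** One factor [p] of the denominator goes to [u p + w p~] and the other to W: the quotient is
    [(u + w p~/p) (p~' - (p~/p) p')], a product of bounded factors on the torus. *)
Lemma wronskian_index_ideal v : in_ideal tau p pt v -> wronskian_index v = +oo%E.
Proof.
case=> u [w [cu cw vE]].
have -> : v = ideal_combination u w.
  by apply/funext => j; apply/funext => k; exact: vE.
have cc : convergent (ideal_combination u w).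
  by apply: convergentD; apply: convergentM => //; exact: taylor_convergent.
apply: isup_pinfty => s s0.
have [Mu uM] := ds_eval_bounded tau cu; have [Mw wM] := ds_eval_bounded tau cw.
have [M1 h1] := ev_bounded pt^`(); have [M2 h2] := ev_bounded p^`().
apply: (@Lp_loc_bounded _ s ((Mu + Mw) * (M1 + M2))) => //.
  by apply: cmeas_near_germ_quotient; exact: convergent_wronskian.
have hE := near_near_torus (wronskian_quotientE cc).
have hC := near_near_torus (ds_eval_combination cu cw).
have hall := near_torusI (near_torusI hE hC)
  (near_torusI (near_torusI uM wM) (near_torusI h1 h2)).
apply: near_torus_imp hall => z z1 z2 [[-> ->] [[hu hw] [hm1 hm2]]].
(* Serves at the zeros of [p], where the quotient is 0 by convention. *)
have M0 : 0 <= (Mu + Mw) * (M1 + M2).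
  by apply: mulr_ge0; apply: addr_ge0; apply: le_trans (nc_ge0 _) _;
    [exact: hu|exact: hw|exact: hm1|exact: hm2].
have [p0|p0] := eqVneq (ev p z) 0.
  by rewrite p0 expr0n /= invr0 mulr0 nc0.
rewrite evB !evM.
have -> : (ds_eval tau u z * ev p z + ds_eval tau w z * ev pt z) *
   (ev pt^`() z * ev p z - ev pt z * ev p^`() z) / ev p z ^+ 2 =
   (ds_eval tau u z + ds_eval tau w z * (ev pt z / ev p z)) *
   (ev pt^`() z - (ev pt z / ev p z) * ev p^`() z) by field.
have uq := unimodular_quotient z1 z2.
rewrite ncM; apply: ler_pM; rewrite ?nc_ge0 //.
  apply: le_trans (ncD _ _) _; apply: lerD => //; rewrite ncM.
  by apply: le_trans hw; rewrite ler_piMr ?nc_ge0.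
apply: le_trans (ncD _ _) _; apply: lerD => //; rewrite ncN ncM.
by apply: le_trans hm2; rewrite ler_piMl ?nc_ge0.
Qed.

Lemma dz1_combination u v : convergent u -> convergent v ->
  near_torus tau (fun z => z <> tau ->
   dz1 (germ_quotient tau (ideal_combination u v) p) z =
   ds_deriv tau u z + ds_deriv tau v z * (ev pt z / ev p z) +
   wronskian_quotient v z).
Proof.
move=> cu cv.
have [Mu du] := ds_deriv_near tau cu; have [Mv dv] := ds_deriv_near tau cv.
have [r r0 rC] := (nbhs_boxP _ _).1 (ds_eval_combination cu cv).
have hall := near_torusI (near_torusI p_isolated
   (near_near_torus (wronskian_quotientE cv)))
  (near_torusI (near_torusI (near_near_torus du) (near_near_torus dv))
               (near_near_torus (near_box tau r0))).
apply: near_torus_imp hall => z z1 z2 [[p0 ->] [[[_ uD] [_ vD]] zr]] ztau.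
have {}p0 := p0 ztau.
have pD := is_derive_ev p z.1 z.2; have ptD := is_derive_ev pt z.1 z.2.
pose U (w : C^o) : C^o := ds_eval tau u (w, z.2).
pose V (w : C^o) : C^o := ds_eval tau v (w, z.2).
pose P (w : C^o) : C^o := ev p (w, z.2).
pose Q (w : C^o) : C^o := ev pt (w, z.2).
have zE : (z.1, z.2) = z by case: (z).
have PVD : is_derive (z.1 : C^o) (1 : C^o) (fun w => (P w)^-1)
    (- (ev p z) ^- 2 *: ev p^`() z : C^o).
  have P0 : P z.1 != 0 by rewrite /P zE.
  apply: DeriveDef; first by apply: derivableV => //; case: pD.
  have PD : is_derive (z.1 : C^o) (1 : C^o) P (ev p^`() z).
    by have := pD; rewrite zE.
  rewrite (deriveV P0 (@ex_derive _ _ _ _ _ _ _ PD)).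
  by rewrite (@derive_val _ _ _ _ _ _ _ PD) {1}/P zE.
have ND := is_deriveD (is_deriveM uD pD) (is_deriveM vD ptD).
have FD := is_deriveM ND PVD.
(* The derivative is complex, so the formula for q/p is needed for [w] off the unit circle too; the
   box is open in C^2 and contains such a slice around [z.1]. *)
have near_eq : \forall w \near (z.1 : C^o),
   ((U * P + V * Q) * (fun w => (P w)^-1)) w =
   germ_quotient tau (ideal_combination u v) p (w, z.2).
  have [e e0 eB] := (nbhs_boxP z _).1 (open_nbhs_nbhs (conj (@open_box _ tau r r0) zr)).
  apply/nbhs_ballP; exists e%:C; first by rewrite /= ltcR.
  move=> w; rewrite /ball /= -ncB_ball => we.
  have : box tau r (w, z.2) by apply: eB; split => //=; rewrite subrr nc0.
  by move=> /rC h; rewrite /germ_quotient h.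
have := near_eq_is_derive near_eq FD.
rewrite /dz1 derive1E => D; rewrite (@derive_val _ _ _ _ _ _ _ D) zE /=.
rewrite evB !evM.
have -> : (U * P + V * Q) z.1 =
    ds_eval tau u z * ev p z + ds_eval tau v z * ev pt z.
  by rewrite -[in RHS]zE.
rewrite /P zE.
transitivity ((ds_eval tau u z * ev p z + ds_eval tau v z * ev pt z) *
    (- ev p z ^- 2 * ev p^`() z) + (ev p z)^-1 *
    (ds_eval tau u z * ev p^`() z + ev p z * ds_deriv tau u z +
    (ds_eval tau v z * ev pt^`() z + ev pt z * ds_deriv tau v z))).
  by [].
by field.
Qed.

Lemma integrability_sup_dz1 u v : convergent u -> convergent v ->
  integrability_sup tau (dz1 (germ_quotient tau (ideal_combination u v) p)) =
  wronskian_index v.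
Proof.
move=> cu cv; have dE := dz1_combination cu cv.
pose B z := ds_deriv tau u z + ds_deriv tau v z * (ev pt z / ev p z).
have [Mu uM] := ds_deriv_near tau cu; have [Mv vM] := ds_deriv_near tau cv.
have lB s : 0 < s -> Lp_loc s tau B.
  move=> s0; apply: (@Lp_loc_bounded _ s (Mu + Mv)) => //.
    apply: cmeas_nearD; first exact: cmeas_near_ds_deriv.
    apply: cmeas_nearM; first exact: cmeas_near_ds_deriv.
    apply: cmeas_nearM; first exact: cmeas_near_ev.
    by apply: cmeas_nearV; exact: cmeas_near_ev.
  have hall := near_torusI (near_near_torus uM) (near_near_torus vM).
  apply: near_torus_imp hall => z z1 z2 [[hu _] [hv _]].
  apply: le_trans (ncD _ _) _; apply: lerD => //; rewrite ncM.
  by apply: le_trans hv; rewrite ler_piMr ?nc_ge0 // unimodular_quotient.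
apply: isup_eq => s s0; split => h.
  have := Lp_locD s0 h (Lp_locZ (-1) s0 (lB s s0)).
  apply: Lp_loc_eq; apply: near_torus_sub dE => z dE zt.
  by rewrite (dE zt) -/(B z); ring.
have := Lp_locD s0 (lB s s0) h; apply: Lp_loc_eq.
by apply: near_torus_sub dE => z dE zt; rewrite (dE zt).
Qed.

End Germs.

(** * The quotient of the local ring *)

Section BivariateBezout.
Variable F : closedFieldType.
Implicit Types (d a b p q : {poly {poly F}}) (c r : {poly F}) (x : F).

Definition no_common_factor p q := forall d a b, p = d * a -> q = d * b ->
  exists c : F, d = c%:P%:P.

Local Notation at_inner x p := (map_poly (horner_eval x) p).

(** Over an algebraically closed field, [d] is primitive over the inner variable exactly when no
    [at_inner x d] vanishes; primitivity is used in this form. *)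
Lemma at_inner_eq0 x a : at_inner x a = 0 -> exists a', a = ('X - x%:P) *: a'.
Proof.
move=> ax; exists (map_poly (fun c => c %/ ('X - x%:P)) a).
apply/polyP => i; rewrite coefZ coef_map_id0 ?div0p // mulrC.
rewrite divpK // dvdp_XsubCl; apply/rootP.
by have := congr1 (fun s : {poly F} => s`_i) ax; rewrite coef_map coef0.
Qed.

(* Gauss's lemma, one linear factor of the scalar at a time. *)
Lemma primitive_cancel (s : seq F) d a p :
  (forall x, at_inner x d != 0) ->
  (\prod_(x <- s) ('X - x%:P)) *: p = d * a -> exists a', p = d * a'.
Proof.
move=> dprim; elim: s a => [|x s IH] a.
  by rewrite big_nil scale1r => ->; exists a.
rewrite big_cons -scalerA => pa.
have : at_inner x a = 0.
  have := congr1 (fun p => at_inner x p) pa.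
  rewrite rmorphM /= map_polyZ /= /horner_eval hornerXsubC subrr scale0r.
  by move/esym/eqP; rewrite mulf_eq0 (negPf (dprim x)) => /eqP.
case/at_inner_eq0 => a' aE; apply: (IH a').
have X0 : ('X - x%:P)%:P != 0 :> {poly {poly F}} by rewrite polyC_eq0 polyXsubC_eq0.
by apply: (mulfI X0); rewrite !mul_polyC pa aE scalerAr.
Qed.

Lemma gauss_cancel c d a p : c != 0 -> (forall x, at_inner x d != 0) ->
  c *: p = d * a -> exists a', p = d * a'.
Proof.
move=> c0 dprim; have [s sE] := closed_field_poly_normal c.
rewrite sE => pa; apply: (@primitive_cancel s d ((lead_coef c)^-1%:P *: a)) => //.
rewrite -scalerAr -pa scalerA -[lead_coef c *: _]mul_polyC mulrA -polyCM.
by rewrite mulVf ?lead_coef_eq0 // mul1r.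
Qed.

(** Applied to the coefficients of a bivariate polynomial, it provides the content. *)
Lemma seq_gcdp (s : seq {poly F}) : exists g, (forall c, c \in s -> g %| c) /\
  (forall h, (forall c, c \in s -> h %| c) -> h %| g).
Proof.
elim: s => [|c s [g [gs gmax]]]; first by exists 0; split => // h _; rewrite dvdp0.
exists (gcdp c g); split.
  move=> c'; rewrite inE => /orP[/eqP ->|/gs]; first exact: dvdp_gcdl.
  exact: dvdp_trans (dvdp_gcdr _ _).
move=> h hs; rewrite dvdp_gcd hs ?mem_head //=; apply: gmax => c' c's.
by apply: hs; rewrite inE c's orbT.
Qed.

(** Division by the content [g]: a common root [x] of the new coefficients would make
    [('X - x%:P) * g] divide [g]. *)
Lemma primitive_part d : d != 0 -> exists g d',
  [/\ g != 0, d = g *: d' & forall x, at_inner x d' != 0].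
Proof.
move=> d0; have [g [gd gmax]] := seq_gcdp d.
have gcoef i : g %| d`_i.
  have [id|id] := ltnP i (size d); first exact/gd/mem_nth.
  by rewrite nth_default // dvdp0.
have g0 : g != 0.
  apply: contra d0 => /eqP g0; apply/eqP/polyP => i; rewrite coef0.
  by have := gcoef i; rewrite g0 dvd0p => /eqP.
have dE : d = g *: map_poly (fun c => c %/ g) d.
  apply/polyP => i; rewrite coefZ coef_map_id0 ?div0p // mulrC.
  by rewrite divpK.
exists g, (map_poly (fun c => c %/ g) d); split => // x.
apply/negP => /eqP /at_inner_eq0[a aE].
have : ('X - x%:P) * g %| g.
  apply: gmax => c /(nthP 0)[i id <-]; rewrite dE aE scalerA coefZ [g * _]mulrC.
  exact: dvdp_mulIl.
move/(dvdp_leq g0); rewrite size_proper_mul ?lead_coefXsubC ?mul1r ?lead_coef_eq0 //.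
by rewrite size_XsubC /= ltnn.
Qed.

(** The resultant lies in the ideal. If it vanished, [gcdp p q] would have positive outer degree.
    This gcd divides [p] and [q] only up to a factor from the coefficient ring, and Gauss's lemma
    makes its primitive part a true common factor. *)
Lemma bivariate_bezout p q : p != 0 -> q != 0 -> no_common_factor p q ->
  exists a b r, r != 0 /\ a * p + b * q = r%:P.
Proof.
move=> p0 q0 nc_pq.
have const_case (u : {poly {poly F}}) : u != 0 -> (size u <= 1)%N -> exists2 r, r != 0 & u = r%:P.
  move=> u0 u1; exists u`_0; last exact: size1_polyC.
  by apply: contra u0 => /eqP h; rewrite (size1_polyC u1) h.
(* [resultant_in_ideal] asks for positive outer degrees; a polynomial of outer degree 0 is itself
   the required [r]. *)
have [p1|p1] := leqP (size p) 1.
  have [r r0 pE] := const_case p p0 p1.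
  by exists 1, 0, r; split => //; rewrite mul1r mul0r addr0.
have [q1|q1] := leqP (size q) 1.
  have [r r0 qE] := const_case q q0 q1.
  by exists 0, 1, r; split => //; rewrite mul1r mul0r add0r.
have [[a b] _ /= E] := resultant_in_ideal p1 q1.
exists a, b, (resultant p q); split => //.
rewrite resultant_eq0 -leqNgt leqNgt; apply/negP => d1.
have d0 : gcdp p q != 0 by rewrite gcdp_eq0 negb_and p0.
have [g [d [g0 dE dprim]]] := primitive_part d0.
have div u : gcdp p q %| u -> exists a', u = d * a'.
  move/Pdiv.Idomain.dvdpP => [[c v] /= c0 uE].
  apply: (@gauss_cancel c d (g *: v)) => //.
  by rewrite uE dE -scalerAr mulrC scalerAr.
have [a' pE] := div p (dvdp_gcdl _ _); have [b' qE] := div q (dvdp_gcdr _ _).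
have [c dc] := nc_pq d a' b' pE qE.
move: d1; rewrite dE size_scale // dc size_polyC; by case: (_ != _).
Qed.

Lemma no_common_factor_swap p q : no_common_factor p q ->
  no_common_factor (swapXY p) (swapXY q).
Proof.
move=> nc_pq d a b pE qE.
have [c dE] : exists c : F, swapXY d = c%:P%:P.
  apply: (nc_pq _ (swapXY a) (swapXY b)); rewrite -rmorphM /=.
    by rewrite -pE swapXYK.
  by rewrite -qE swapXYK.
by exists c; rewrite -[d]swapXYK dE swapXY_polyC map_polyC.
Qed.

(** [r^:P] is [r] in the outer variable z_1, whereas [r%:P] is [r] in the inner variable z_2. *)
Lemma bivariate_bezout_swap p q : p != 0 -> q != 0 -> no_common_factor p q ->
  exists a b r, r != 0 /\ a * p + b * q = r^:P.
Proof.
move=> p0 q0 /no_common_factor_swap.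
case/bivariate_bezout; rewrite ?swapXY_eq0 // => a [b [r [r0 E]]].
exists (swapXY a), (swapXY b), r; split => //.
by rewrite -swapXY_polyC -E rmorphD !rmorphM /= !swapXYK.
Qed.

End BivariateBezout.

(** * Common zeros are isolated *)

Section IsolatedZeros.
Variable R : realType.
Local Notation C := R[i].
Local Notation nc := (@ComplexField.Normc.normc R).
Implicit Types (p q : {poly {poly C}}) (z tau : C * C).

Lemma seq_isolated (s : seq C) (y0 : C) : exists2 e : R, 0 < e &
  forall y, nc (y - y0) < e -> y \in s -> y = y0.
Proof.
elim: s => [|x s [e e0 IH]]; first by exists 1.
have [->|xy] := eqVneq x y0.
  by exists e => // y ye; rewrite inE => /orP[/eqP //|]; exact: IH.
exists (Num.min e (nc (x - y0))); first by rewrite lt_min e0 nc_gt0 subr_eq0.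
move=> y; rewrite lt_min => /andP[ye yx]; rewrite inE => /orP[/eqP yE|]; last exact: IH.
by move: yx; rewrite yE ltxx.
Qed.

Lemma root_isolated (r : {poly C}) (y0 : C) : r != 0 -> exists2 e : R, 0 < e &
  forall y, nc (y - y0) < e -> r.[y] = 0 -> y = y0.
Proof.
move=> r0; have [s [_ sP]] := horner_prod_roots r0.
have [e e0 h] := seq_isolated s y0; exists e => // y ye ry.
apply: h => //; move/eqP: ry; rewrite sP mulf_eq0 lead_coef_eq0 (negPf r0) /=.
rewrite prodf_seq_eq0 => /hasP[c cs /=]; rewrite subr_eq0 => /eqP ->.
exact: cs.
Qed.

(** At a common zero the members [r] (in z_2) and [r'] (in z_1) of the ideal vanish, and the roots
    of each are isolated. *)
Lemma isolated_zeros p q tau : p != 0 -> q != 0 -> no_common_factor p q ->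
  \forall z \near (tau : C^o * C^o), ev p z = 0 -> ev q z = 0 -> z = tau.
Proof.
move=> p0 q0 nc_pq.
have [a [b [r [r0 E]]]] := bivariate_bezout p0 q0 nc_pq.
have [a' [b' [r' [r'0 E']]]] := bivariate_bezout_swap p0 q0 nc_pq.
have [e1 e10 h1] := root_isolated tau.1 r'0.
have [e2 e20 h2] := root_isolated tau.2 r0.
have e0 : 0 < Num.min e1 e2 by rewrite lt_min e10.
apply: filterS (near_box tau e0) => z [].
rewrite !lt_min => /andP[z1 _] /andP[_ z2] pz qz.
have rz : r.[z.2] = 0.
  have := congr1 (fun P => ev P z) E; rewrite evD !evM pz qz !mulr0 addr0.
  by rewrite /ev hornerC.
have rz' : r'.[z.1] = 0.
  have := congr1 (fun P => ev P z) E'; rewrite evD !evM pz qz !mulr0 addr0.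
  by rewrite /ev horner_map hornerC.
by move: (h1 _ z1 rz') (h2 _ z2 rz); case: (z) (tau) => ? ? [? ?] /= -> ->.
Qed.

End IsolatedZeros.

(** * Ring laws for germs and inverses of polynomials *)

Section SeriesAlgebra.
Variable R : realType.
Local Notation C := R[i].
Local Notation nc := (@ComplexField.Normc.normc R).
Implicit Types (a b f g h u v : dseries R) (A B : {poly {poly C}}) (tau : C * C).

Definition coef2 A : dseries R := fun j k => A`_j`_k.

(** A coefficient of a product depends on finitely many coefficients of the factors, so the laws of
    [ds_mul] are inherited from [{poly {poly C}}] through truncation. *)
Definition trunc2 n f : {poly {poly C}} := \poly_(j < n) \poly_(k < n) f j k.

Lemma coef2_trunc n f j k : (j < n)%N -> (k < n)%N -> coef2 (trunc2 n f) j k = f j k.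
Proof. by move=> jn kn; rewrite /coef2 /trunc2 !coef_poly jn coef_poly kn. Qed.

Lemma coef2M A B : coef2 (A * B) = ds_mul (coef2 A) (coef2 B).
Proof.
apply/funext => j; apply/funext => k.
rewrite /coef2 /ds_mul coefM coef_sum; apply: eq_bigr => j' _.
by rewrite coefM.
Qed.

Lemma eq_ds_mul j k f f' g g' :
  (forall i l, (i <= j)%N -> (l <= k)%N -> f i l = f' i l) ->
  (forall i l, (i <= j)%N -> (l <= k)%N -> g i l = g' i l) ->
  ds_mul f g j k = ds_mul f' g' j k.
Proof.
move=> ff gg; apply: eq_bigr => i _; apply: eq_bigr => l _.
by rewrite ff ?gg ?leq_subr // -ltnS ltn_ord.
Qed.

Lemma ds_mulC f g : ds_mul f g = ds_mul g f.
Proof.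
apply/funext => j; apply/funext => k; pose n := (maxn j k).+1.
have tr (w : dseries R) i l : (i <= j)%N -> (l <= k)%N ->
    w i l = coef2 (trunc2 n w) i l.
  by move=> ij lk; rewrite coef2_trunc // ltnS leq_max ?ij ?lk ?orbT.
rewrite (eq_ds_mul (tr f) (tr g)) -coef2M mulrC coef2M.
by apply: eq_ds_mul => i l ij lk; rewrite -tr.
Qed.

Lemma ds_mulA f g h : ds_mul f (ds_mul g h) = ds_mul (ds_mul f g) h.
Proof.
apply/funext => j; apply/funext => k; pose n := (maxn j k).+1.
have tr (w : dseries R) i l : (i <= j)%N -> (l <= k)%N ->
    w i l = coef2 (trunc2 n w) i l.
  by move=> ij lk; rewrite coef2_trunc // ltnS leq_max ?ij ?lk ?orbT.
have trM (w w' : dseries R) i l : (i <= j)%N -> (l <= k)%N ->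
    ds_mul w w' i l = coef2 (trunc2 n w * trunc2 n w') i l.
  move=> ij lk; rewrite coef2M; apply: eq_ds_mul => i' l' i'i l'l;
    by rewrite -tr // ?(leq_trans i'i) ?(leq_trans l'l).
rewrite (eq_ds_mul (tr f) (trM g h)) -coef2M mulrA coef2M.
by apply: eq_ds_mul => i l ij lk; rewrite ?trM // -tr.
Qed.

Lemma ds_mulDl f g h : ds_mul (fun j k => f j k + g j k) h =
  fun j k => ds_mul f h j k + ds_mul g h j k.
Proof.
apply/funext => j; apply/funext => k.
rewrite /ds_mul -big_split; apply: eq_bigr => i _ /=.
by rewrite -big_split; apply: eq_bigr => l _ /=; rewrite mulrDl.
Qed.

Lemma ds_mulZl (c : C) f h : ds_mul (fun j k => c * f j k) h =
  fun j k => c * ds_mul f h j k.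
Proof.
apply/funext => j; apply/funext => k.
rewrite /ds_mul mulr_sumr; apply: eq_bigr => i _ /=.
by rewrite mulr_sumr; apply: eq_bigr => l _ /=; rewrite mulrA.
Qed.

Definition ds_one : dseries R := fun j k => ((j == 0%N) && (k == 0%N))%:R.

Lemma coef2_1 : coef2 1 = ds_one.
Proof.
rewrite /ds_one; apply/funext => j; apply/funext => k; rewrite /coef2 coef1.
by case: (j == 0%N); [exact: coef1|exact: coef0].
Qed.

Lemma coef2X : coef2 'X = fun j k => ((j == 1%N) && (k == 0%N))%:R.
Proof.
apply/funext => j; apply/funext => k; rewrite /coef2 coefX.
by case: (j == 1%N); [exact: coef1|exact: coef0].
Qed.

Lemma coef2C (c : C) :
  coef2 c%:P%:P = fun j k => c * ds_one j k.
Proof.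
rewrite /ds_one; apply/funext => j; apply/funext => k.
rewrite /coef2 (coefC (c%:P : {poly C}) j).
case: (j == 0%N); last by rewrite mulr0; exact: coef0.
by rewrite (coefC c k) /=; case: (k == 0%N); rewrite ?mulr1 ?mulr0.
Qed.

Lemma coef2B A B : coef2 (A - B) = fun j k => coef2 A j k - coef2 B j k.
Proof.
by apply/funext => j; apply/funext => k; rewrite /coef2 coefB; exact: coefB.
Qed.

Lemma ds_mul1 f : ds_mul ds_one f = f.
Proof.
rewrite -coef2_1; apply/funext => j; apply/funext => k; pose n := (maxn j k).+1.
have tr (w : dseries R) i l : (i <= j)%N -> (l <= k)%N ->
    w i l = coef2 (trunc2 n w) i l.
  by move=> ij lk; rewrite coef2_trunc // ltnS leq_max ?ij ?lk ?orbT.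
rewrite (@eq_ds_mul _ _ _ (coef2 1) _ (coef2 (trunc2 n f))) //; last exact: tr.
by rewrite -coef2M mul1r -tr.
Qed.

Lemma translateD tau A B : translate tau (A + B) = translate tau A + translate tau B.
Proof. by rewrite /translate rmorphD /= comp_polyD. Qed.

Lemma translateM tau A B : translate tau (A * B) = translate tau A * translate tau B.
Proof. by rewrite /translate rmorphM /= comp_polyM. Qed.

Lemma taylorM tau A B : taylor tau (A * B) = ds_mul (taylor tau A) (taylor tau B).
Proof. by rewrite -[LHS]/(coef2 _) translateM coef2M. Qed.

Lemma taylorD tau A B : taylor tau (A + B) =
  fun j k => taylor tau A j k + taylor tau B j k.
Proof.
by apply/funext => j; apply/funext => k; rewrite /taylor translateD !coefD.
Qed.

Definition ds_swap f : dseries R := fun j k => f k j.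

Lemma ds_swap_mul f g : ds_swap (ds_mul f g) = ds_mul (ds_swap f) (ds_swap g).
Proof.
by apply/funext => j; apply/funext => k; rewrite /ds_swap /ds_mul exchange_big.
Qed.

Lemma dsum_swap (V : nmodType) (G : nat -> nat -> V) n :
  dsum (fun j k => G k j) n = dsum G n.
Proof. by rewrite /dsum exchange_big. Qed.

Lemma convergent_swap f : convergent f -> convergent (ds_swap f).
Proof.
move=> /convergentP[r r0 [M fM]]; apply/convergentP; exists r => //; exists M => n.
by rewrite -dsum_swap; apply: le_trans (fM n); apply: ler_dsum => j k; rewrite addnC.
Qed.

Lemma convergent_coef2 A : convergent (coef2 A).
Proof.
have := taylor_convergent (0, 0) A; apply: eq_convergent => j k.
rewrite /taylor /translate /= !addr0 comp_polyXr.
by rewrite map_poly_id // => c _; rewrite comp_polyXr.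
Qed.

(** The geometric series of 1/(X - rho); at radius [nc rho / 2] its absolute sums stay below
    [2 / nc rho]. *)
Lemma ds_inv_linear (rho : C) : rho != 0 -> exists2 v, convergent v &
  ds_mul (coef2 ('X - rho%:P%:P)) v = ds_one.
Proof.
move=> rho0; pose v : dseries R := fun j k => if k == 0%N then - rho ^- j.+1 else 0.
have cv : convergent v.
  apply/convergentP; exists (nc rho / 2); first by rewrite divr_gt0 // nc_gt0.
  exists ((nc rho)^-1 * 2) => n.
  have n0 : 0 < nc rho by rewrite nc_gt0.
  rewrite /dsum.
  apply: le_trans (_ : \sum_(j < n) (nc rho)^-1 * 2^-1 ^+ j <= _).
    apply: ler_sum => j _; rewrite (bigID (fun k : 'I_n => k == 0%N :> nat)) /=.
    rewrite [X in _ + X]big1 ?addr0; last first.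
      by move=> k /negPf k0; rewrite /v k0 nc0 mul0r.
    case: n j => [[]//|n] j.
    rewrite (big_pred1 ord0) //=; rewrite /v /= ncN ncV ncX addn0 exprMn exprS.
    rewrite invfM -!mulrA ler_wpM2l ?invr_ge0 ?nc_ge0 // mulrA mulVf ?mul1r //.
    by rewrite expf_neq0 // gt_eqF.
  rewrite -mulr_sumr ler_wpM2l ?invr_ge0 ?nc_ge0 //.
  have -> : \sum_(j < n) 2^-1 ^+ j = 2 - 2 * 2^-1 ^+ n :> R.
    elim: (n) => [|m IH]; first by rewrite big_ord0 expr0; ring.
    by rewrite big_ord_recr /= IH exprS; field.
  by rewrite gerBl mulr_ge0 // exprn_ge0 // invr_ge0.
exists v => //; apply/funext => j; apply/funext => k.
rewrite /ds_one /ds_mul.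
have cX i l : coef2 ('X - rho%:P%:P) i l =
   ((i == 1%N) && (l == 0%N))%:R - rho * ((i == 0%N) && (l == 0%N))%:R.
  by rewrite coef2B coef2X coef2C.
have [k0|k0] := posnP k; last first.
  rewrite andbF big1 // => i _; rewrite big1 // => l _; rewrite cX /v.
  have [->|_] := eqVneq (l : nat) 0%N; last first.
    by rewrite !andbF mulr0 subrr mul0r.
  by rewrite subn0 (gtn_eqF k0) mulr0.
rewrite k0 andbT.
under eq_bigr => i _ do rewrite big_ord1 cX /v /= !andbT.
case: j => [|j].
  by rewrite big_ord1 /= mulr1 sub0r expr1 mulrN mulNr opprK divff.
rewrite big_ord_recl big_ord_recl big1 ?addr0 /=; last first.
  by move=> i _; rewrite mulr0 subr0 mul0r.
rewrite mulr1 sub0r mulr0 subr0 mul1r /bump /= subn0 subn1 /= mulNr mulrN opprK.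
by rewrite exprS invfM mulrA divff // mul1r subrr.
Qed.

(** A nonzero constant term makes all roots nonzero, so the inverse is a product of geometric
    series, up to a scalar. *)
Lemma ds_inv_poly (u : {poly C}) : u.[0] != 0 -> exists2 v, convergent v &
  ds_mul (coef2 (u^:P)) v = ds_one.
Proof.
move=> u0.
have un0 : u != 0 by apply: contra u0 => /eqP ->; rewrite horner0.
have [s sE] := closed_field_poly_normal u.
have s0 : all (fun rho => rho != 0) s.
  apply/allP => rho rs; apply: contra u0 => /eqP rho0.
  rewrite sE hornerZ horner_prod mulf_eq0; apply/orP; right.
  rewrite prodf_seq_eq0; apply/hasP; exists rho => //=.
  by rewrite hornerXsubC rho0 subrr.
have key : forall s, all (fun rho => rho != 0) s -> exists2 v, convergent v &
   ds_mul (coef2 ((\prod_(x <- s) ('X - x%:P))^:P)) v = ds_one.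
  elim=> [_|x s' IH /= /andP[x0 /IH[v cv vE]]].
    exists ds_one; first by rewrite -coef2_1; exact: convergent_coef2.
    by rewrite big_nil rmorph1 coef2_1 ds_mul1.
  have [g cg gE] := ds_inv_linear x0.
  exists (ds_mul g v); first exact: convergentM.
  rewrite big_cons rmorphM /= coef2M rmorphB /= map_polyX map_polyC /=.
  rewrite -ds_mulA [ds_mul _ (ds_mul g v)]ds_mulA [ds_mul (coef2 _) g]ds_mulC.
  by rewrite -ds_mulA vE ds_mulA gE ds_mul1.
have [v cv vE] := key s s0.
have l0 : lead_coef u != 0 by rewrite lead_coef_eq0.
have uE : u^:P = (lead_coef u)%:P%:P * (\prod_(x <- s) ('X - x%:P))^:P.
  by rewrite {1}sE -mul_polyC rmorphM /= map_polyC.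
have kE : coef2 (lead_coef u)%:P%:P = fun j k => lead_coef u * ds_one j k.
  by rewrite coef2C.
exists (fun j k => (lead_coef u)^-1 * v j k); first exact: convergentZ.
rewrite ds_mulC ds_mulZl [ds_mul v _]ds_mulC uE coef2M kE.
rewrite -ds_mulA vE ds_mulZl ds_mul1.
by apply/funext => j; apply/funext => k; rewrite mulrA mulVf // mul1r.
Qed.

End SeriesAlgebra.

(** * Finite dimension of the quotient *)

Section FiniteDimension.
Variable R : realType.
Local Notation C := R[i].
Local Notation nc := (@ComplexField.Normc.normc R).
Implicit Types (f g h u v : dseries R) (p q A B : {poly {poly C}}).

Lemma ds_mul_lin (c : C) u v h : ds_mul (fun j k => u j k + c * v j k) h =
  fun j k => ds_mul u h j k + c * ds_mul v h j k.
Proof. by rewrite (ds_mulDl u (fun j k => c * v j k) h) (ds_mulZl c v h). Qed.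

Lemma ds_mul_combination h f u g v :
  ds_mul h (fun j k => ds_mul f u j k + ds_mul g v j k) =
  fun j k => ds_mul (ds_mul h f) u j k + ds_mul (ds_mul h g) v j k.
Proof.
by rewrite ds_mulC ds_mulDl (ds_mulC _ h) (ds_mulC _ h) (ds_mulA h f) (ds_mulA h g).
Qed.

Lemma in_ideal_lin (c : C) tau p q f g : in_ideal tau p q f ->
  in_ideal tau p q g -> in_ideal tau p q (fun j k => f j k + c * g j k).
Proof.
case=> u [v [cu cv fE]] [u' [v' [cu' cv' gE]]].
exists (fun j k => u j k + c * u' j k), (fun j k => v j k + c * v' j k); split.
- by apply: convergentD => //; exact: convergentZ.
- by apply: convergentD => //; exact: convergentZ.
move=> j k.
rewrite (ds_mul_lin c u u' (taylor tau p)).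
rewrite (ds_mul_lin c v v' (taylor tau q)).
rewrite fE gE mulrDr.
exact: addrACA.
Qed.

Lemma eq_in_ideal tau p q f g : (forall j k, f j k = g j k) ->
  in_ideal tau p q f -> in_ideal tau p q g.
Proof.
by move=> fg [u [v [cu cv fE]]]; exists u, v; split => // j k; rewrite -fg fE.
Qed.

Lemma in_ideal0 tau p q : in_ideal tau p q (fun _ _ => 0).
Proof.
exists (fun _ _ => 0), (fun _ _ => 0); split; try exact: convergent0.
move=> j k; have Z f : ds_mul (fun _ _ => 0) f j k = 0.
  by rewrite /ds_mul big1 // => i _; rewrite big1 // => l _; rewrite mul0r.
rewrite (Z (taylor tau p)) (Z (taylor tau q)).
exact/esym/addr0.
Qed.

Lemma in_ideal_taylor tau p q A B h : convergent h ->
  in_ideal tau p q (ds_mul h (taylor tau (A * p + B * q))).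
Proof.
move=> ch; exists (ds_mul h (taylor tau A)), (ds_mul h (taylor tau B)); split.
- by apply: convergentM => //; exact: taylor_convergent.
- by apply: convergentM => //; exact: taylor_convergent.
move=> j k.
rewrite (taylorD tau (A * p) (B * q)) (taylorM tau A p) (taylorM tau B q).
by rewrite ds_mul_combination.
Qed.

Lemma coef2_swapXY A : coef2 (swapXY A) = ds_swap (coef2 A).
Proof. by apply/funext => j; apply/funext => k; exact: coef_swapXY. Qed.

Lemma coef2_mulXn m g j k :
  ds_mul (coef2 'X^m) g j k = if (j < m)%N then 0 else g (j - m)%N k.
Proof.
pose n := (maxn j k).+1.
have tr i l : (i <= j)%N -> (l <= k)%N -> g i l = coef2 (trunc2 n g) i l.
  by move=> ij lk; rewrite coef2_trunc // ltnS leq_max ?ij ?lk ?orbT.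
rewrite (@eq_ds_mul _ _ _ _ (coef2 'X^m) _ (coef2 (trunc2 n g))) //.
rewrite -coef2M /coef2 coefXnM; case: ifP => jm; first by rewrite coef0.
by rewrite tr // leq_subr.
Qed.

Lemma translate_outer tau (r : {poly C}) :
  translate tau r^:P = (r \Po ('X + tau.1%:P))^:P.
Proof.
rewrite /translate map_comp_poly rmorphD /= map_polyX map_polyC; congr (_ \Po _).
rewrite -map_poly_comp_id0 ?comp_polyC //.
by apply: eq_map_poly => c /=; rewrite comp_polyC.
Qed.

Lemma translate_inner tau (r : {poly C}) :
  translate tau r%:P = (r \Po ('X + tau.2%:P))%:P.
Proof. by rewrite /translate map_polyC /= comp_polyC. Qed.

Lemma factor_at0 (s : {poly C}) : s != 0 -> exists m (w : {poly C}), w.[0] != 0 /\ s = w * 'X^m.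
Proof.
move=> s0; have [m [u]] := multiplicity_XsubC s 0.
by rewrite s0 subr0 /root => u0 sE; exists m, u.
Qed.

Lemma comp_shift_neq0 (r : {poly C}) (x : C) : r != 0 -> r \Po ('X + x%:P) != 0.
Proof.
by move=> r0; rewrite -size_poly_eq0 size_comp_poly2 ?size_XaddC // size_poly_eq0.
Qed.

Lemma ideal_outer_power tau p q A B (r : {poly C}) : r != 0 ->
  A * p + B * q = r^:P ->
  exists m, forall g, convergent g -> in_ideal tau p q (ds_mul (coef2 'X^m) g).
Proof.
move=> r0 E; have [m [u [u0 sE]]] := factor_at0 (comp_shift_neq0 tau.1 r0).
have [v cv vE] := ds_inv_poly u0; exists m => g cg.
have := in_ideal_taylor tau p q A B (convergentM cg cv).
rewrite E -[taylor _ _]/(coef2 (translate tau r^:P)) translate_outer sE.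
rewrite rmorphM /= map_polyXn coef2M -ds_mulA [ds_mul v _]ds_mulA.
by rewrite [ds_mul v _]ds_mulC vE ds_mul1 ds_mulC.
Qed.

(** [swapXY] and [ds_swap] turn the inner variable into the outer one, so that the inversion of
    [u^:P] serves here too. *)
Lemma ideal_inner_power tau p q A B (r : {poly C}) : r != 0 ->
  A * p + B * q = r%:P ->
  exists n, forall g, convergent g ->
    in_ideal tau p q (ds_swap (ds_mul (coef2 'X^n) g)).
Proof.
move=> r0 E; have [n [u [u0 sE]]] := factor_at0 (comp_shift_neq0 tau.2 r0).
have [v cv vE] := ds_inv_poly u0; exists n => g cg.
have := in_ideal_taylor tau p q A B (convergent_swap (convergentM cg cv)).
rewrite E -[taylor _ _]/(coef2 (translate tau r%:P)) translate_inner sE.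
rewrite -[(u * 'X^n)%:P]swapXYK coef2_swapXY -ds_swap_mul swapXY_polyC.
rewrite rmorphM /= map_polyXn coef2M -ds_mulA [ds_mul v _]ds_mulA.
by rewrite [ds_mul v _]ds_mulC vE ds_mul1 ds_mulC.
Qed.

(** The terms with exponent at least [m], divided by [X^m]; the radius is kept at the price of the
    factor [r ^- m]. *)
Lemma convergent_shift f m : convergent f -> convergent (fun j k => f (j + m)%N k).
Proof.
move=> /convergentP[r r0 [M fM]]; apply/convergentP; exists r => //.
exists (r ^- m * M) => n.
apply: le_trans (_ : r ^- m * dsum (fun j k => nc (f j k) * r ^+ (j + k)) (n + m) <= _);
  last by rewrite ler_wpM2l // invr_ge0 exprn_ge0 // ltW.
have F0 j k : 0 <= nc (f j k) * r ^+ (j + k).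
  by rewrite mulr_ge0 ?nc_ge0 // exprn_ge0 // ltW.
rewrite -ler_pdivrMl ?invr_gt0 ?exprn_gt0 // invrK /dsum mulr_sumr.
rewrite addnC big_split_ord /=.
apply: le_trans (_ : \sum_(j < n) \sum_(k < m + n)
   nc (f (m + j)%N k) * r ^+ (m + j + k) <= _); last first.
  rewrite lerDr; apply: sumr_ge0 => j _; exact: sumr_ge0.
apply: ler_sum => j _; rewrite mulr_sumr (addnC m n) big_split_ord /=.
apply: le_trans (_ : \sum_(k < n) nc (f (m + j)%N k) * r ^+ (m + j + k) <= _).
  apply: ler_sum => k _; rewrite [r ^+ m * _]mulrC -mulrA -exprD.
  by rewrite (addnC m j) addnAC.
by rewrite lerDl; apply: sumr_ge0.
Qed.

Lemma convergent_mask f (P : nat -> nat -> bool) : convergent f ->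
  convergent (fun j k => if P j k then f j k else 0).
Proof.
move=> /convergentP[r r0 [M fM]]; apply/convergentP; exists r => //; exists M => n.
apply: le_trans (fM n); apply: ler_dsum => j k; case: ifP => // _.
by rewrite nc0 mul0r mulr_ge0 ?nc_ge0 // exprn_ge0 // ltW.
Qed.

Definition ds_monomial (a b : nat) : dseries R :=
  fun j k => ((j == a) && (k == b))%:R.

Lemma convergent_monomial a b : convergent (ds_monomial a b).
Proof.
have -> : ds_monomial a b =
    (fun j k => if (j == a) && (k == b) then coef2 (trunc2 (maxn a b).+1
       (fun _ _ => 1)) j k else 0).
  apply/funext => j; apply/funext => k; rewrite /ds_monomial.
  case: ifP => // /andP[/eqP -> /eqP ->].
  by rewrite coef2_trunc // ltnS leq_max leqnn ?orbT.
by apply: convergent_mask; exact: convergent_coef2.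
Qed.

Lemma sum_monomials m n f j k :
  \sum_(x : 'I_m * 'I_n) f x.1 x.2 * ds_monomial x.1 x.2 j k =
  if (j < m)%N && (k < n)%N then f j k else 0.
Proof.
case: ifP => [/andP[jm kn]|jk].
  rewrite (bigD1 (Ordinal jm, Ordinal kn)) //= /ds_monomial !eqxx mulr1.
  rewrite big1 ?addr0 // => -[a b]; rewrite xpair_eqE -!val_eqE /=.
  by rewrite eq_sym [(b : nat) == _]eq_sym => /negPf ->; rewrite mulr0.
rewrite big1 // => -[a b] _; rewrite /ds_monomial /=.
case: eqP => [ja|_]; last by rewrite mulr0.
case: eqP => [kb|_]; last by rewrite mulr0.
by move: jk; rewrite ja kb !ltn_ord.
Qed.

Definition spanning tau p q N (e : 'I_N -> dseries R) : Prop :=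
  (forall i, convergent (e i)) /\
  (forall f, convergent f -> exists c : 'I_N -> C,
     in_ideal tau p q (fun j k => f j k - \sum_(i < N) c i * e i j k)).

(** The coefficients of [f] are split: those with [j >= m] form a multiple of one power in the
    ideal, those with [j < m] and [k >= n] a multiple of the other, and [m n] monomials span the
    rest. *)
Lemma exists_spanning tau p q : p != 0 -> q != 0 -> no_common_factor p q ->
  exists N (e : 'I_N -> dseries R), spanning tau p q e.
Proof.
move=> p0 q0 nc_pq.
have [a [b [r [r0 E]]]] := bivariate_bezout p0 q0 nc_pq.
have [a' [b' [r' [r'0 E']]]] := bivariate_bezout_swap p0 q0 nc_pq.
have [m idm] := ideal_outer_power tau r'0 E'.
have [n idn] := ideal_inner_power tau r0 E.
pose T : finType := ('I_m * 'I_n)%type.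
pose x_ (i : 'I_#|T|) : 'I_m * 'I_n := enum_val i.
exists #|T|, (fun i => ds_monomial (x_ i).1 (x_ i).2).
split=> [i|f cf]; first exact: convergent_monomial.
exists (fun i => f (x_ i).1 (x_ i).2).
pose g j k := f (j + m)%N k.
(* The restriction [j < m] avoids counting twice the terms that [g] already holds; the arguments are
   exchanged because [h] is used under [ds_swap]. *)
pose h k j := if (j < m)%N then f j (k + n)%N else 0.
have cg : convergent g by exact: convergent_shift.
have ch : convergent h.
  apply: (@convergent_mask (fun k j => f j (k + n)%N) (fun k j => (j < m)%N)).
  have := convergent_shift n (convergent_swap cf).
  by apply: eq_convergent.
apply: eq_in_ideal (in_ideal_lin 1 (idm g cg) (idn h ch)) => j k.
have -> : \sum_(i < #|T|) f (x_ i).1 (x_ i).2 * ds_monomial (x_ i).1 (x_ i).2 j k =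
    \sum_(x : 'I_m * 'I_n) f x.1 x.2 * ds_monomial x.1 x.2 j k.
  by rewrite [RHS](reindex x_) //; exact/onW_bij/enum_val_bij.
rewrite sum_monomials mul1r /ds_swap !coef2_mulXn /g /h.
have [jm|jm] := ltnP j m; have [kn|kn] := ltnP k n; rewrite /= ?subnK //.
- by rewrite addr0 subrr.
- by rewrite add0r subr0.
- by rewrite addr0 subr0.
- by rewrite addr0 subr0.
Qed.

(** A spanning family of least size: two distinct coordinate vectors of one germ give a relation
    with nonzero coefficient at some [i0], and then [e i0] could be dropped. *)
Lemma exists_quotient_basis tau p q : p != 0 -> q != 0 -> no_common_factor p q ->
  exists N (e : 'I_N -> dseries R), quotient_basis tau p q e.
Proof.
move=> p0 q0 nc_pq.
have ex : exists N, `[< exists e : 'I_N -> dseries R, spanning tau p q e >].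
  by have [N [e eP]] := exists_spanning tau p0 q0 nc_pq; exists N; apply/asboolP; exists e.
case: (ex_minnP ex) => N /asboolP[e [ce eS]] minN.
exists N, e; split => // f cf; have [c cP] := eS f cf.
exists [ffun i => c i]; split.
  by apply: eq_in_ideal cP => j k; congr (_ - _); apply: eq_bigr => i _; rewrite ffunE.
move=> c' c'P; apply/ffunP => i0; apply/eqP; rewrite ffunE eq_sym.
apply: contraT => cc'.
have dP : in_ideal tau p q (fun j k => \sum_(i < N) (c i - c' i) * e i j k).
  have := in_ideal_lin (-1) c'P cP; apply: eq_in_ideal => j k.
  rewrite mulN1r opprB addrC addrA subrK -sumrB; apply: eq_bigr => i _.
  by rewrite mulrBl.
case: N e ce eS minN c c' i0 cP c'P cc' dP => [|N] e ce eS minN c c' i0 cP c'P cc' dP.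
  by have := ltn_ord i0; rewrite ltn0.
suff : (N.+1 <= N)%N by rewrite ltnn.
apply: minN; apply/asboolP; exists (fun i => e (lift i0 i)); split => // f1 cf1.
have [c1 c1P] := eS f1 cf1.
pose d i := c i - c' i.
have d0 : d i0 != 0 by rewrite subr_eq0 eq_sym.
exists (fun i => c1 (lift i0 i) - c1 i0 / d i0 * d (lift i0 i)).
have := in_ideal_lin (c1 i0 / d i0) c1P dP; apply: eq_in_ideal => j k.
rewrite -/(d _) !(bigD1_ord i0) //= mulrDr -/(d i0) mulrA divfK //.
have -> : \sum_(i < N) (c1 (lift i0 i) - c1 i0 / d i0 * d (lift i0 i)) *
   e (lift i0 i) j k = \sum_(i < N) c1 (lift i0 i) * e (lift i0 i) j k -
   c1 i0 / d i0 * \sum_(i < N) (c (lift i0 i) - c' (lift i0 i)) * e (lift i0 i) j k.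
  by rewrite mulr_sumr -sumrB; apply: eq_bigr => i _; rewrite mulrBl mulrA.
ring.
Qed.

(** Some basis exists, so [xget] returns the size of one and not its default 0. *)
Lemma intersection_multiplicity_basis tau p q : p != 0 -> q != 0 ->
  no_common_factor p q ->
  exists e : 'I_(intersection_multiplicity tau p q) -> dseries R,
    quotient_basis tau p q e.
Proof.
move=> p0 q0 nc_pq; have [N Ne] := exists_quotient_basis tau p0 q0 nc_pq.
exact: (@xgetI _ 0%N [set N | exists e : 'I_N -> dseries R,
  quotient_basis tau p q e] N Ne).
Qed.

End FiniteDimension.

(** * Counting the indices *)

Section ValuationValues.
Variables (R : realType) (F : fieldType) (N : nat) (chi : 'rV[F]_N -> \bar R).
Hypothesis chiD : forall x y, (Order.min (chi x) (chi y) <= chi (x + y)%R)%E.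
Hypothesis chiZ : forall c x, (chi x <= chi (c *: x)%R)%E.
Hypothesis chi0 : chi 0 = +oo%E.

Definition finite_values (s : seq (\bar R)) :=
  forall v, v \in s -> v <> +oo%E /\ exists x, chi x = v.

(* In a linear relation, the term of least index would be a combination of terms
   of larger index. *)
Lemma finite_values_size s : uniq s -> finite_values s -> (size s <= N)%N.
Proof.
move=> us sP.
have /choice[x xP] : forall i : 'I_(size s), exists x, chi x = nth +oo%E s i.
  by move=> i; have [_] := sP _ (mem_nth +oo%E (ltn_ord i)).
pose A : 'M[F]_(size s, N) := \matrix_i x i.
suff /eqP <- : row_free A by exact: rank_leq_col.
apply: inj_row_free => l lA; apply/eqP/contraT => /rV0Pn[i1 l1].
case: (@Order.TotalTheory.arg_minP _ _ _ i1 (fun i => l 0 i != 0)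
  (fun i : 'I_(size s) => nth +oo%E s i) l1) => i0 l0 min0.
set b := nth +oo%E s i0.
have b_fin : (b < +oo)%E.
  by rewrite ltey; apply/eqP; have [] := sP _ (mem_nth +oo%E (ltn_ord i0)).
(* Terms with coefficient 0 have value [+oo]; the others exceed [b], which is least among values
   without repetition. *)
have sum_gt : (b < chi (\sum_(i | i != i0) l 0 i *: x i)%R)%E.
  elim/big_ind: _ => [|y z yb zb|i ii0]; first by rewrite chi0.
    by apply: lt_le_trans (chiD y z); rewrite lt_min yb.
  have [->|li] := eqVneq (l 0 i) 0; first by rewrite scale0r chi0.
  apply: lt_le_trans (chiZ (l 0 i) (x i)); rewrite xP lt_neqAle min0 // andbT.
  by rewrite nth_uniq ?ltn_ord // eq_sym.
have xE : x i0 = - (l 0 i0)^-1 *: \sum_(i | i != i0) l 0 i *: x i.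
  move: lA; rewrite mulmx_sum_row (bigD1 i0) //= rowK => /eqP.
  rewrite addr_eq0 => /eqP lx; rewrite scaleNr -scalerN.
  under eq_bigr do rewrite -(rowK x).
  by rewrite -lx scalerA mulVf // scale1r.
have := lt_le_trans sum_gt (chiZ (- (l 0 i0)^-1) _).
by rewrite -xE xP ltxx.
Qed.

(** A repetition-free list of finite values of greatest length, which [finite_values_size] bounds; a
    missing finite value would extend it. *)
Lemma exists_finite_values : exists s : seq (\bar R),
  [/\ (size s <= N)%N, finite_values s &
      forall x, chi x \in s \/ chi x = +oo%E].
Proof.
pose P n := `[< exists s, [/\ size s = n, uniq s & finite_values s] >].
have P0 : exists n, P n by exists 0%N; apply/asboolP; exists [::].
have PN n : P n -> (n <= N)%N.
  by move/asboolP => [s [<- us]]; exact: finite_values_size.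
case: (ex_maxnP P0 PN) => n /asboolP[s [sn us sP]] nmax.
exists s; split=> // [|x]; first exact: finite_values_size.
have [xs|xs] := boolP (chi x \in s); first by left.
right; apply/eqP; apply: contraT => /eqP xoo.
suff : (n.+1 <= n)%N by rewrite ltnn.
apply: nmax; apply/asboolP; exists (chi x :: s); split => /=; rewrite ?sn ?xs //.
move=> v; rewrite inE => /orP[/eqP ->|]; last exact: sP.
by split => //; exists x.
Qed.

End ValuationValues.

Section WronskianIndices.
Variable R : realType.
Local Notation C := R[i].
Variables (p : {poly {poly C}}) (tau : C * C).
Hypothesis p_neq0 : p != 0.
Local Notation pt := (reflection p).
Local Notation index := (wronskian_index p tau).
Implicit Types (v w : dseries R).

Lemma eq_wronskian_index v w : (forall j k, v j k = w j k) -> index v = index w.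
Proof. by move=> vw; congr index; apply/funext => j; apply/funext => k. Qed.

(** The difference has index [+oo], so [wronskian_indexD] yields one inequality; exchanging [v] and
    [w] yields the other. *)
Lemma wronskian_index_mod v w : convergent v -> convergent w ->
  in_ideal tau p pt (fun j k => v j k - w j k) -> index v = index w.
Proof.
move=> cv cw vw.
have le v' w' : convergent v' -> convergent w' ->
    in_ideal tau p pt (fun j k => v' j k - w' j k) -> (index w' <= index v')%E.
  move=> cv' cw' vw'.
  have c : convergent (fun j k => v' j k - w' j k).
    by apply: convergentD => //; exact: convergentN.
  have := wronskian_indexD tau p_neq0 cw' c.
  rewrite (wronskian_index_ideal vw').
  have -> : index (fun j k => w' j k + (v' j k - w' j k)) = index v'.
    by apply: eq_wronskian_index => j k; rewrite addrC subrK.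
  by rewrite min_l ?leey.
apply/eqP; rewrite eq_le; apply/andP; split; apply: le => //.
have := in_ideal_lin (-1) (in_ideal0 tau p pt) vw.
by apply: eq_in_ideal => j k; rewrite add0r mulN1r opprB.
Qed.

End WronskianIndices.

(** * Consequences of atoral stability *)

Section AtoralStable.
Variable R : realType.
Local Notation C := R[i].
Local Notation nc := (@ComplexField.Normc.normc R).
Variables (p : {poly {poly C}}) (tau : C * C).
Hypothesis p_atoral_stable : atoral_stable p.
Hypothesis p_tau : ev p tau = 0.

Lemma atoral_stable_neq0 : p != 0.
Proof.
case: p_atoral_stable => + _ => /(_ (0, 0)); rewrite /= normr0 ltr01.
by move=> /(_ isT isT); apply: contra => /eqP ->; rewrite /ev !horner0.
Qed.

(** If p~ were 0, [p] itself would be a common factor, hence constant, hence 0 because it vanishes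
    at [tau]. *)
Lemma reflection_neq0 : reflection p != 0.
Proof.
case: p_atoral_stable => _ common; apply/eqP => pt0.
have [c pE] : exists c : C, p = c%:P%:P.
  apply: (common p 1 0); first exact: (esym (mulr1 p)).
  by rewrite (mulr0 p); exact: pt0.
move: p_tau atoral_stable_neq0; rewrite pE /ev !hornerC => ->.
by rewrite !polyC0 eqxx.
Qed.

Lemma atoral_no_common_factor : no_common_factor p (reflection p).
Proof. by case: p_atoral_stable. Qed.

(** On the torus a zero of [p] is also a zero of p~, so the isolation of common zeros applies. *)
Lemma atoral_isolated : near_torus tau (fun z => z <> tau -> ev p z != 0).
Proof.
have := isolated_zeros tau atoral_stable_neq0 reflection_neq0
          atoral_no_common_factor.
move/near_near_torus; apply: near_torus_imp => z z1 z2 h ztau.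
apply/eqP => pz; apply: ztau; apply: h => //.
by apply/eqP; rewrite -nc_eq0 nc_reflection // pz nc0.
Qed.

End AtoralStable.

Theorem theorem6p10 (R : realType) (p : {poly {poly R[i]}}) (tau : R[i] * R[i])
    (p_atoral_stable : atoral_stable p)
    (tau1_unit : `|tau.1| = 1) (tau2_unit : `|tau.2| = 1)
    (p_tau : ev p tau = 0) :
  exists (M : nat) (pp : 'I_M.+1 -> \bar R),
    [/\ (M <= intersection_multiplicity tau p (reflection p))%N,
        pp ord_max = +oo%E,
        (forall j : 'I_M.+1, integrability_index tau (p ^+ 2) (pp j)) &
        (forall q : dseries R, in_ideal tau p (reflection p) q ->
           exists j : 'I_M.+1,
             integrability_sup tau (dz1 (germ_quotient tau q p)) = pp j)].
Proof.
have p_neq0 := atoral_stable_neq0 p_atoral_stable.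
have pt_neq0 := reflection_neq0 p_atoral_stable p_tau.
have p_isolated := atoral_isolated p_atoral_stable p_tau.
have [e [ce eB]] := intersection_multiplicity_basis tau p_neq0 pt_neq0
  (atoral_no_common_factor p_atoral_stable).
set N := intersection_multiplicity _ _ _ in e ce eB *.
(* Coordinates in the basis turn classes of germs into row vectors, on which the values of the index
   are counted by linear algebra. *)
pose comb (c : 'rV[R[i]]_N) : dseries R :=
  fun j k => \sum_(i < N) c 0 i * e i j k.
have comb_conv c : convergent (comb c).
  by apply: convergent_sum => i; exact: convergentZ.
pose chi c := wronskian_index p tau (comb c).
have chiD x y : (Order.min (chi x) (chi y) <= chi (x + y)%R)%E.
  apply: le_trans (wronskian_indexD tau p_neq0 (comb_conv x) (comb_conv y)) _.
  rewrite le_eqVlt; apply/orP; left; apply/eqP; apply: eq_wronskian_index => j k.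
  by rewrite -big_split; apply: eq_bigr => i _; rewrite mxE mulrDl.
have chiZ c x : (chi x <= chi (c *: x)%R)%E.
  apply: le_trans (wronskian_indexZ p tau c (comb_conv x)) _.
  rewrite le_eqVlt; apply/orP; left; apply/eqP; apply: eq_wronskian_index => j k.
  by rewrite mulr_sumr; apply: eq_bigr => i _; rewrite mxE mulrA.
have chi0 : chi 0 = +oo%E.
  apply: wronskian_index_ideal; apply: eq_in_ideal (in_ideal0 tau p _) => j k.
  by rewrite /comb big1 // => i _; rewrite mxE mul0r.
have index_comb v : convergent v -> exists c, wronskian_index p tau v = chi c.
  move=> cv; have [c [cP _]] := eB v cv.
  exists (\row_i c i); apply: wronskian_index_mod => //.
  apply: eq_in_ideal cP => j k; congr (_ - _).
  by apply: eq_bigr => i _; rewrite mxE.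
have chi_index c : integrability_index tau (p ^+ 2) (chi c).
  split; first exact: wronskian_index_gt0.
  by exists (ds_mul (comb c) (taylor tau (wronskian p))) => //;
    exact: convergent_wronskian.
have [s [sN sP s_all]] := exists_finite_values chiD chiZ chi0.
(* The default of [nth] supplies the value [+oo] at the last index [size s]. *)
exists (size s), (fun j => nth +oo%E s j); split => //.
- by rewrite nth_default.
- move=> j; have [js|js] := ltnP j (size s).
    by have [_ [c <-]] := sP _ (mem_nth +oo%E js).
  (* [+oo] is itself an integrability index, realised by the combination with all coefficients 0. *)
  by rewrite nth_default // -chi0.
move=> q [u [v [cu cv qE]]].
have -> : q = ideal_combination p tau u v.
  by apply/funext => j; apply/funext => k; exact: qE.
rewrite integrability_sup_dz1 //.
have [c ->] := index_comb v cv.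
case: (s_all c) => [/(nthP +oo%E)[j js <-]|->].
  by exists (inord j); rewrite inordK // ltnS ltnW.
by exists ord_max; rewrite nth_default.
Qed.
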